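(* For any braid $b$ whose closure is a knot and any $p\in\mathbb{C}$, the infinite sum $S_b(\exp(h/2),p)$ converges in the $h$-adic topology of $\mathbb{C}[[h]]$.
   Context: Let $[n]=\frac{q^n-q^{-n}}{q-q^{-1}}$, $[n]!=[1]\cdots[n]$, $[0]!=1$. For half-integers $I,J,K\ge 0$ and $m,n,r$ with $|m|\le I$, $|n|\le J$, $|r|\le K$, $I-m,J-n,K-r\in\mathbb{Z}$, $m+n=r$, $|I-J|\le K\le I+J$, $I+J+K\in\mathbb{Z}$, define the $q$-Clebsch–Gordan coefficient $$\langle I m,J n|K r\rangle=q^{m(r+1)+\frac12(J(J+1)-I(I+1)-K(K+1))}(-1)^{I-m}\sqrt{\tfrac{[2K+1][I+J-K]![I-m]![J-n]![K-r]![K+r]!}{[K+J-I]![I+K-J]![I+J+K+1]![I+m]![J+n]!}}\sum_{V}\tfrac{q^{V(K+r+1)}(-1)^V[I+m+V]![J+K-m-V]!}{[V]![K-r-V]![I-m-V]![J-K+m+V]!},$$ $V$ running over integers with $\max(0,K-J-m)\le V\le\min(K-r,I-m)$; otherwise it is $0$. Put $$\Lambda^{BC}_{AD}(p)=\sum_\sigma\langle C\,\sigma,B\,(-\sigma)|A\,0\rangle\,q^{2\sigma p}\,\langle B\,(-\sigma),C\,\sigma|D\,0\rangle .$$ Let $V(p)$ have basis $v^\beta_k$, $\beta\in\{0,1,2,\dots\}$, $k=-\beta,\dots,\beta$. For $\alpha\in\frac12\mathbb{N}_0$ and $i,j\in\{-\alpha,\dots,\alpha\}$ (unit steps) define operators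 on $V(p)$: $X(\alpha)^i_j v^\beta_k=\delta_{\alpha\beta}\delta_{ik}v^\alpha_j$; $\;Gv^\beta_k=q^{2k}v^\beta_k$; $$g(\alpha)^i_jv^\beta_k=\sum_{D,\gamma,l,x}\langle\gamma\, l,\alpha\, i|D\,x\rangle\langle\alpha\, j,\beta\, k|D\,x\rangle\,\Lambda^{\alpha D}_{\gamma\beta}(p)\,v^\gamma_l ;$$ and $\bar g(\alpha)^j_i=q^{-i+j}(-1)^{i-j}g(\alpha)^{-i}_{-j}$. Let $b$ be a braid with $m+1$ strands, given as a word in $\sigma_1^{\pm1},\dots,\sigma_m^{\pm1}$ with $n$ letters, whose closure is a knot. Label the $k$-th crossing by $(\alpha_k,i_k,j_k)$, $\alpha_k\in\frac12\mathbb{N}_0$, $i_k,j_k\in\{-\alpha_k,\dots,\alpha_k\}$. Follow the closed braid starting at the bottom of position 1, reading the letters in order, until the top of position 1 is reached. Passing a letter $\sigma_s$ (the $k$-th crossing) from position $s$ to $s+1$ record $X(\alpha_k)^{i_k}_{j_k}$, and from $s+1$ to $s$ record $g(\alpha_k)^{j_k}_{i_k}$; passing a letter $\sigma_s^{-1}$ from $s+1$ to $s$ record $X(\alpha_k)^{i_k}_{j_k}$, and from $s$ to $s+1$ record $\bar g(\alpha_k)^{j_k}_{i_k}$; each time the top of a position $\ge2$ is reached record $G$ and continue at the bottom of that position. Let $T$ be the composition of the recorded operators, later ones on the left. Then $S_b(q,p)=\sum\langle v^0_0,T v^0_0\rangle$, the sum over all labels of the coefficient of $v^0_0$ in $Tv^0_0$.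 For $q=\exp(h/2)$ each term is analytic in $h$ near $0$ and is regarded as an element of $\mathbb{C}[[h]]$; $S_b(\exp(h/2),p)$ is the resulting infinite sum of power series. *)

(* Defs.v *)
From mathcomp Require Import all_boot all_order all_algebra all_fingroup finmap.
From mathcomp Require Import all_classical all_reals all_analysis.
From mathcomp Require Import complex.

Set Implicit Arguments.
Unset Strict Implicit.
Unset Printing Implicit Defensive.

Import Order.TTheory GRing.Theory Num.Theory.
Import numFieldNormedType.Exports.

Local Open Scope ring_scope.
Local Open Scope complex_scope.

(** * Clebsch-Gordan coefficients

    Half-integers are elements of [rat].  The deformation parameter [q] is a
    positive real, [q <> 1]; at [q = 1] the quantum integers are [0/0] and the
    definitions below are meaningless. *)

Section ClebschGordan.
Variables (R : realType) (q : R).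

Definition qint (n : nat) : R := (q ^+ n - q ^- n) / (q - q^-1).

(* [truncn] recovers a natural number from its image in [rat]; every argument
   occurring below is a natural number. *)
Definition qfact (x : rat) : R := \prod_(1 <= k < (Num.truncn x).+1) qint k.

Definition qpow (x : rat) : R := q `^ ratr x.

Definition half_integer (x : rat) : bool := 2 * x \is a Num.int.

Definition cg_cond (I m J n K r : rat) : bool :=
  [&& [&& half_integer I, half_integer J & half_integer K],
      [&& `|m| <= I, `|n| <= J & `|r| <= K],
      [&& I - m \is a Num.int, J - n \is a Num.int & K - r \is a Num.int],
      m + n == r,
      `|I - J| <= K <= I + J
    & I + J + K \is a Num.int].

(* <I m, J n | K r> *)
Definition cg (I m J n K r : rat) : R :=
  if cg_cond I m J n K r then
    qpow (m * (r + 1) + (J * (J + 1) - I * (I + 1) - K * (K + 1)) / 2)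
    * (-1) ^+ Num.truncn (I - m)
    * Num.sqrt
        (qint (Num.truncn (2 * K + 1)) * qfact (I + J - K) * qfact (I - m)
           * qfact (J - n) * qfact (K - r) * qfact (K + r)
         / (qfact (K + J - I) * qfact (I + K - J) * qfact (I + J + K + 1)
              * qfact (I + m) * qfact (J + n)))
    * \sum_(Num.truncn (Num.max 0 (K - J - m)) <= V
              < (Num.truncn (Num.min (K - r) (I - m))).+1)
        (qpow (V%:R * (K + r + 1)) * (-1) ^+ V
           * qfact (I + m + V%:R) * qfact (J + K - m - V%:R)
         / (qfact V%:R * qfact (K - r - V%:R)
              * qfact (I - m - V%:R) * qfact (J - K + m + V%:R)))
  else 0.

(* q^z = exp(z log q) for complex z and real q > 0 *)
Definition qcpow (z : R[i]) : R[i] :=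
  let t := ln q in
  (expR (t * complex.Re z))%:C
    * (cos (t * complex.Im z) +i* sin (t * complex.Im z)).

End ClebschGordan.

(* -j, -j + 1, ..., j *)
Definition mags (j : rat) : seq rat :=
  [seq t%:R - j | t <- iota 0 (Num.truncn (2 * j)).+1].

(* 0, 1/2, 1, ..., x *)
Definition spins_upto (x : rat) : seq rat :=
  [seq t%:R / 2 | t <- iota 0 (Num.truncn (2 * x)).+1].

(** * Operators on V(p) *)

(* Indices (beta, k) of the basis of V(p): [existT _ b t] stands for
   beta = b and k = t - b. *)
Definition bidx : Type := {b : nat & 'I_(b.*2.+1)}.

Definition bspin (x : bidx) : rat := (tag x)%:R.
Definition bmag (x : bidx) : rat := (tagged x : nat)%:R - (tag x)%:R.

Section Operators.
Variables (R : realType) (q : R) (p : R[i]).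

(* Vectors are given by their coordinates in the basis v^beta_k; those met
   below are finitely supported. *)
Definition vect : Type := bidx -> R[i].

(* v^beta_k, or 0 when (beta, k) does not index a basis vector *)
Definition ket (beta k : rat) : vect :=
  fun y => ((bspin y == beta) && (bmag y == k))%:R.

(* An operator is given by its values on the basis vectors. *)
Definition oper : Type := bidx -> vect.

(* linear extension of an operator; the sum has finite support *)
Definition app (T : oper) (u : vect) : vect :=
  fun y => \sum_(x \in [set: bidx]) (u x * T x y).

(* Lambda^{BC}_{AD}(p); the terms with sigma outside [mags C] vanish. *)
Definition Lambda (B C A D : rat) : R[i] :=
  \sum_(s <- mags C)
    (cg q C s B (- s) A 0)%:C * qcpow q (2 * ratr s * p)
    * (cg q B (- s) C s D 0)%:C.

Definition opX (alpha i j : rat) : oper := fun x y =>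
  ((alpha == bspin x) && (i == bmag x))%:R * ket alpha j y.

Definition opG : oper := fun x y =>
  (qpow q (2 * bmag x))%:C * ket (bspin x) (bmag x) y.

(* g(alpha)^i_j; by the triangle conditions all terms of the sum over D, gamma,
   l, x outside the ranges below vanish. *)
Definition opg (alpha i j : rat) : oper := fun b y =>
  let beta := bspin b in let k := bmag b in
  \sum_(D <- spins_upto (alpha + beta))
   \sum_(gamma <- spins_upto (alpha + D))
    \sum_(l <- mags gamma) \sum_(x <- mags D)
      (cg q gamma l alpha i D x)%:C * (cg q alpha j beta k D x)%:C
      * Lambda alpha D gamma beta * ket gamma l y.

(* gbar(alpha)^j_i *)
Definition opgbar (alpha j i : rat) : oper := fun b y =>
  (qpow q (- i + j))%:C * (-1) ^ Num.floor (i - j)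
  * opg alpha (- i) (- j) b y.

End Operators.

(** * Braids and state sums *)

(* Strand positions 1, ..., m+1 are numbered 0, ..., m; the letter [(s, true)]
   is sigma_(s+1) and [(s, false)] is its inverse. *)
Definition letter (m : nat) : Type := ('I_m * bool)%type.

(* [lpos s] and [rpos s] are the two strand positions exchanged by the letter. *)
Definition lpos (m : nat) (s : 'I_m) : 'I_m.+1 := widen_ord (leqnSn m) s.
Definition rpos (m : nat) (s : 'I_m) : 'I_m.+1 := lift ord0 s.

Definition letter_perm (m : nat) (l : letter m) : 'S_m.+1 :=
  tperm (lpos l.1) (rpos l.1).

(* (s * t)%g is "first s, then t": this maps a bottom position to the top
   position of the same strand. *)
Definition braid_perm (m : nat) (b : seq (letter m)) : 'S_m.+1 :=
  (\prod_(l <- b) letter_perm l)%g.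

(* The components of the closure correspond to the cycles of the permutation. *)
Definition closure_components (m : nat) (b : seq (letter m)) : nat :=
  #|porbits (braid_perm b)|.

Definition closure_is_knot (m : nat) (b : seq (letter m)) : Prop :=
  closure_components b = 1%N.

(* Labels (alpha, i, j): [existT _ a (s, t)] stands for alpha = a/2,
   i = s - alpha, j = t - alpha. *)
Definition label : Type := {a : nat & ('I_a.+1 * 'I_a.+1)%type}.

Definition lab_alpha (L : label) : rat := (tag L)%:R / 2.
Definition lab_i (L : label) : rat := ((tagged L).1 : nat)%:R - lab_alpha L.
Definition lab_j (L : label) : rat := ((tagged L).2 : nat)%:R - lab_alpha L.

Section StateSum.
Variables (R : realType) (q : R) (p : R[i]) (m : nat).

(* operators recorded by a strand at position [x] when it meets a letter *)
Definition crossing (l : letter m) (L : label) (x : 'I_m.+1) : seq (oper R) :=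
  let: (s, positive) := l in
  let alpha := lab_alpha L in let i := lab_i L in let j := lab_j L in
  if x == lpos s then
    [:: if positive then opX R alpha i j else opgbar q p alpha j i]
  else if x == rpos s then
    [:: if positive then opg q p alpha j i else opX R alpha i j]
  else [::].

(* operators recorded from the bottom of position [x] up to the top *)
Fixpoint pass (w : seq (letter m * label)) (x : 'I_m.+1) : seq (oper R) :=
  if w is (l, L) :: w' then crossing l L x ++ pass w' (letter_perm l x)
  else [::].

(* The orbit lists the bottom positions visited before coming
   back to the first one, in order and starting with [ord0]. *)
Definition recorded (b : seq (letter m)) (Ls : seq label) : seq (oper R) :=
  let w := zip b Ls in
  pass w ord0 ++
  flatten [seq opG q :: pass w x | x <- behead (fingraph.orbit (braid_perm b) ord0)].

Definition bidx0 : bidx := existT (fun b => 'I_(b.*2.+1)) 0%N ord0.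

(* <v^0_0, T v^0_0>, where T composes the recorded operators, later ones on
   the left *)
Definition Sb_term (b : seq (letter m)) (Ls : seq label) : R[i] :=
  foldl (fun u T => app T u) (ket R 0 0) (recorded b Ls) bidx0.

End StateSum.

(** * The ring C[[h]] *)

(* [c k] is the coefficient of h^k. *)
Definition fps (R : realType) : Type := nat -> R[i].

(* [f] is analytic near 0 with Taylor series [c].  The value [f 0] is ignored:
   for q = exp(h/2) the singularity at h = 0 is removable. *)
Definition taylor_expansion (R : realType) (f : R -> R[i]) (c : fps R) : Prop :=
  exists2 r : R, 0 < r &
    forall h : R, 0 < `|h| < r ->
      ((fun N => \sum_(k < N) c k * (h ^+ k)%:C : R[i]^o) @ \oo --> (f h : R[i]^o))%classic.

(* The sum over the index set [T] of the power series [a t] converges to [s]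
   in the h-adic topology: the net of finite partial sums converges to [s]. *)
Definition hadic_sum (R : realType) (T : choiceType) (a : T -> fps R)
    (s : fps R) : Prop :=
  forall N : nat, exists F0 : {fset T}, forall F : {fset T},
    (F0 `<=` F)%fset ->
    forall k : nat, (k < N)%N -> \sum_(t <- F) a t k = s k.

Definition hadic_convergent (R : realType) (T : choiceType) (a : T -> fps R) :
  Prop := exists s : fps R, hadic_sum a s.

(* Main.v *)
(* A crossing contributes an X(alpha), which projects to spin alpha, while the
   path starts and ends at spin 0, so some operators g must move the spin from 0
   up to alpha.  The matrix entry of g from spin beta to spin gamma is O(h^(gamma
   - beta)), because Lambda is; hence a term containing the label alpha is
   O(h^alpha), and modulo h^N only finitely many labellings contribute.

   The estimate for Lambda is a quantum form of the orthogonality of Hahn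
   polynomials.  With r = 0 the sum over V is a Rodrigues formula, so the first
   Clebsch-Gordan coefficient is an A-fold q-difference in sigma, and the second
   one, after cancelling the weights, is a q-polynomial of degree D in sigma,
   that is, h^(-D) times a bounded combination of exponentials q^(j sigma).
   Summing by parts, the q-difference hits q^(2 sigma p) q^(j sigma) and yields
   a product of A factors 1 - q^(...), each of which is O(h). *)

Require Import Defs.
From mathcomp Require Import all_boot all_order all_algebra.
From mathcomp Require Import all_classical all_reals all_analysis.
From mathcomp Require Import complex.
From mathcomp Require Import all_fingroup finmap.
From mathcomp Require Import ring lra zify.
Import Order.TTheory GRing.Theory Num.Theory.
Set Implicit Arguments.
Unset Strict Implicit.
Unset Printing Implicit Defensive.
Import numFieldNormedType.Exports.
Local Open Scope ring_scope.

(** * Real functions with a power series expansion at 0 *)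

(** Two kinds of facts about functions of a real h near 0 are kept apart: having a power series
    expansion, and being O(h^k) with k possibly negative. Orders are plain growth bounds because
    intermediate quantities, such as the h^(-D) in front of the exponentials, have poles, while
    complete terms have expansions. The two notions meet at the end: a function that is O(h^N) has
    no Taylor coefficients below N. This is an exact statement about each labelling separately, so
    the constants in the bounds may depend on the labels.

    The delicate point for Lambda is the degree: every difference in the Rodrigues formula brings in
    two quantum numbers, which naively gives degree 2D; a product-to-sum identity shows that the
    leading parts cancel. The summation by parts has no boundary terms, because the sum over sigma
    can be extended until it is, up to a factor, the value at one point of a product of two
    polynomials; the A small factors are then those of the first polynomial. *)

Section PowerSeries.
Variable R : realType.
Implicit Types (c d : nat -> R) (f g : R -> R) (r M : R).

(** A single [M] bounds the absolute sums at radius [r] and the geometric remainders, so that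
    products, inverses and roots are handled by finite estimates instead of limits. For [n] = 0 the
    last clause says |f| <= M. The point h = 0 is left out because a division by q - q^-1 has a
    meaningless value there. *)
Definition expands_in r M c f :=
  [/\ 0 < r,
      forall n, \sum_(k < n) `|c k| * r ^+ k <= M
    & forall h, 0 < `|h| < r -> forall n,
        `|f h - \sum_(k < n) c k * h ^+ k| <= M * (`|h| / r) ^+ n].

Definition expands c f := exists r M, expands_in r M c f.

Lemma expands_in_ge0 r M c f : expands_in r M c f -> 0 <= M.
Proof. by case=> _ /(_ 0); rewrite big_ord0. Qed.

Lemma expands_inW r r' M M' c f : 0 < r' <= r -> M <= M' ->
  expands_in r M c f -> expands_in r' M' c f.
Proof.
move=> /andP[r'0 r'r] MM' cf; have M0 := expands_in_ge0 cf.
case: cf => r0 cM fM; split=> // [n|h /andP[h0 hr'] n].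
  apply: le_trans MM'; apply: le_trans (cM n); apply: ler_sum => k _.
  by apply: ler_wpM2l => //; apply: lerXn2r => //; rewrite nnegrE ltW.
have hr : 0 < `|h| < r by rewrite h0 (lt_le_trans hr').
apply: le_trans (fM _ hr n) _; apply: ler_pM => //.
  by rewrite exprn_ge0// divr_ge0// ltW.
apply: lerXn2r; rewrite ?nnegrE ?divr_ge0 ?(ltW r0) ?(ltW r'0)//.
by apply: ler_wpM2l => //; rewrite lef_pV2.
Qed.

Lemma expands_common c d f g : expands c f -> expands d g ->
  exists r M, expands_in r M c f /\ expands_in r M d g.
Proof.
move=> [r [M cf]] [s [N dg]]; exists (Num.min r s), (Num.max M N).
have [r0 _ _] := cf; have [s0 _ _] := dg.
split; [apply: expands_inW cf|apply: expands_inW dg].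
- by rewrite lt_min r0 s0 ge_min lexx.
- by rewrite le_max lexx.
- by rewrite lt_min r0 s0 ge_min lexx orbT.
- by rewrite le_max lexx orbT.
Qed.

Lemma expands_ext c f g : (forall h, h != 0 -> f h = g h) ->
  expands c f -> expands c g.
Proof.
move=> fg [r [M [r0 cM fM]]]; exists r, M; split=> // h /[dup] /andP[h0 _] hr n.
by rewrite -fg ?fM// -normr_gt0.
Qed.

Lemma expandsD c d f g : expands c f -> expands d g ->
  expands (fun k => c k + d k) (fun h => f h + g h).
Proof.
move=> cf dg; have [r [M [[r0 cM fM] [_ dM gM]]]] := expands_common cf dg.
exists r, (M + M); split=> // [n|h hr n].
  apply: le_trans (lerD (cM n) (dM n)); rewrite -big_split/=.
  by apply: ler_sum => k _; rewrite -mulrDl ler_wpM2r ?ler_normD// exprn_ge0// ltW.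
rewrite mulrDl; apply: le_trans (lerD (fM _ hr n) (gM _ hr n)).
apply: le_trans (ler_normD _ _); rewrite le_eqVlt; apply/orP; left; apply/eqP.
congr `|_|; under eq_bigr do rewrite mulrDl.
by rewrite big_split/= opprD addrACA.
Qed.

Definition conv c d n := \sum_(i < n.+1) c i * d (n - i)%N.

(** Truncated series are treated as polynomials: below degree [n] the product of two truncations has
    the coefficients of the Cauchy product, and its coefficients from [n] on are the error. *)
Let poly_conv n (c d : nat -> R) k : (k < n)%N ->
  (\poly_(i < n) c i * \poly_(i < n) d i)`_k = conv c d k.
Proof.
move=> kn; rewrite coefM; apply: eq_bigr => i _; rewrite !coef_poly.
by rewrite (leq_ltn_trans _ kn) ?leq_ord// (leq_ltn_trans (leq_subr _ _) kn).
Qed.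

Let poly_norm n c d k :
  `|(\poly_(i < n) c i * \poly_(i < n) d i)`_k| <=
  (\poly_(i < n) `|c i| * \poly_(i < n) `|d i|)`_k.
Proof.
rewrite !coefM; apply: le_trans (ler_norm_sum _ _ _) _; apply: ler_sum => i _.
by rewrite !coef_poly normrM ler_pM//; case: ifP => //; rewrite normr0.
Qed.

Let horner_trunc n c x : (\poly_(i < n) c i).[x] = \sum_(i < n) c i * x ^+ i.
Proof. by rewrite horner_poly. Qed.

Let horner_prod2 n c d x :
  (\poly_(i < n) c i * \poly_(i < n) d i).[x] =
  \sum_(k < n + n) (\poly_(i < n) c i * \poly_(i < n) d i)`_k * x ^+ k.
Proof.
apply: horner_coef_wide; apply: leq_trans (size_polyMleq _ _) _.
rewrite (leq_trans (leq_pred _))// leq_add// size_poly//.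
Qed.

(** The right side is the value at [r] of a product of polynomials with nonnegative coefficients;
    its terms of degree at least [n] are dropped. *)
Lemma conv_norm_le c d r n : 0 <= r ->
  \sum_(k < n) `|conv c d k| * r ^+ k <=
  (\sum_(k < n) `|c k| * r ^+ k) * (\sum_(k < n) `|d k| * r ^+ k).
Proof.
move=> r0; rewrite -(horner_trunc n (fun k => `|c k|)).
rewrite -(horner_trunc n (fun k => `|d k|)) -hornerM horner_prod2 big_split_ord/=.
rewrite -[leLHS]addr0; apply: lerD; last first.
  by apply: sumr_ge0 => i _; rewrite mulr_ge0 ?exprn_ge0// (le_trans _ (poly_norm _ _ _ _)).
apply: ler_sum => i _; apply: ler_wpM2r; first exact: exprn_ge0.
by rewrite -(@poly_conv n).
Qed.

(** Only terms of degree k >= n of the product of the truncations survive on the left, and for them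
    |x|^k <= r^k (|x|/r)^n. *)
Lemma conv_trunc_le c d r x n : 0 < r -> `|x| <= r ->
  `|(\sum_(k < n) c k * x ^+ k) * (\sum_(k < n) d k * x ^+ k)
    - \sum_(k < n) conv c d k * x ^+ k| <=
  (\sum_(k < n) `|c k| * r ^+ k) * (\sum_(k < n) `|d k| * r ^+ k)
   * (`|x| / r) ^+ n.
Proof.
move=> r0 xr; have r00 := ltW r0.
have y0 : 0 <= `|x| / r by rewrite divr_ge0.
have y1 : `|x| / r <= 1 by rewrite ler_pdivrMr// mul1r.
rewrite -!horner_trunc -hornerM horner_prod2 big_split_ord/= horner_trunc.
under eq_bigr do rewrite poly_conv//.
rewrite [X in `|X|]addrC addKr -(horner_trunc n (fun k => `|c k|)).
rewrite -(horner_trunc n (fun k => `|d k|)) -hornerM horner_prod2 big_split_ord/=.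
rewrite mulrDl -[leLHS]add0r; apply: lerD.
  apply: mulr_ge0; last exact: exprn_ge0.
  by apply: sumr_ge0 => i _; rewrite mulr_ge0 ?exprn_ge0// (le_trans _ (poly_norm _ _ _ _)).
apply: le_trans (ler_norm_sum _ _ _) _; rewrite mulr_suml; apply: ler_sum => i _.
rewrite normrM -mulrA; apply: ler_pM => //.
rewrite normrX -{1}(divfK (lt0r_neq0 r0) `|x|) exprMn mulrC.
by apply: ler_wpM2l; [exact: exprn_ge0|rewrite exprD ler_piMr ?exprn_ge0// exprn_ile1].
Qed.

Lemma expandsM c d f g : expands c f -> expands d g ->
  expands (conv c d) (fun h => f h * g h).
Proof.
move=> cf dg; have [r [M [cfM dgM]]] := expands_common cf dg.
have M0 := expands_in_ge0 cfM.
case: cfM dgM => r0 cM fM [_ dM gM].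
have tM (e : nat -> R) (eM : forall n, \sum_(k < n) `|e k| * r ^+ k <= M) h n :
    `|h| < r -> `|\sum_(k < n) e k * h ^+ k| <= M.
  move=> hr; apply: le_trans (eM n); apply: le_trans (ler_norm_sum _ _ _) _.
  apply: ler_sum => k _; rewrite normrM normrX ler_wpM2l// lerXn2r ?nnegrE//.
    exact: ltW.
  exact: ltW.
have S0 (e : nat -> R) n : 0 <= \sum_(k < n) `|e k| * r ^+ k.
  by apply: sumr_ge0 => k _; rewrite mulr_ge0// exprn_ge0// ltW.
(* One [M * M] for each part of the splitting f (g - B) + (f - A) B + (A B - truncated Cauchy
   product), where A and B are the truncations. *)
exists r, (M * M + M * M + M * M); split=> // [n|h /[dup] hr0 /andP[h0 hr] n].
  apply: le_trans (conv_norm_le _ _ _ (ltW r0)) _.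
  apply: (@le_trans _ _ (M * M)); first exact: ler_pM.
  by rewrite -addrA lerDl addr_ge0// mulr_ge0.
have fh : `|f h| <= M by have := fM h hr0 0%N; rewrite big_ord0 subr0 expr0 mulr1.
set A := \sum_(k < n) c k * h ^+ k; set B := \sum_(k < n) d k * h ^+ k.
have y0 : 0 <= (`|h| / r) ^+ n by rewrite exprn_ge0// divr_ge0// ltW.
rewrite (_ : _ - _ = f h * (g h - B) + (f h - A) * B +
   (A * B - \sum_(k < n) conv c d k * h ^+ k)); last by ring.
rewrite [leRHS]mulrDl; apply: le_trans (ler_normD _ _) _; apply: lerD; last first.
  apply: le_trans (conv_trunc_le c d n r0 (ltW hr)) _.
  by apply: ler_wpM2r => //; exact: ler_pM.
rewrite [leRHS]mulrDl; apply: le_trans (ler_normD _ _) _; rewrite !normrM; apply: lerD.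
  by rewrite -mulrA; apply: ler_pM => //; exact: gM.
by rewrite mulrAC; apply: ler_pM => //; [exact: fM|exact: tM].
Qed.

Lemma expands_cst a : expands (fun k => if k is 0 then a else 0) (fun=> a).
Proof.
exists 1, `|a|; split=> // [n|h _ n].
  case: n => [|n]; first by rewrite big_ord0.
  by rewrite big_ord_recl/= big1 ?addr0 ?expr0 ?mulr1// => i _; rewrite normr0 mul0r.
case: n => [|n]; first by rewrite big_ord0 subr0 expr0 mulr1.
rewrite big_ord_recl/= big1 => [|i _]; last by rewrite mul0r.
by rewrite addr0 expr0 mulr1 subrr normr0 mulr_ge0// exprn_ge0// divr_ge0.
Qed.

(** Course-of-values recursion, the source of the coefficients of inverses and square roots. [tab n]
    is correct below [n] and arbitrary from there on; [Fext] says that [F] does not see the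
    difference. *)
Lemma strong_rec (F : (nat -> R) -> nat -> R) :
  (forall d d' n, (forall k, (k < n)%N -> d k = d' k) -> F d n = F d' n) ->
  exists d, forall n, d n = F d n.
Proof.
move=> Fext.
pose tab := fix tab n := if n is n'.+1 then
  fun k => if (k < n')%N then tab n' k else F (tab n') n' else fun=> 0 : R.
pose d k := tab k.+1 k.
have tabE n k : (k < n)%N -> tab n k = d k.
  elim: n k => // n IHn k; rewrite ltnS leq_eqVlt => /orP[/eqP->//|kn].
  by rewrite -IHn//= kn.
by exists d => n; rewrite {1}/d/= ltnn; apply: Fext => k; exact: tabE.
Qed.

Lemma expands_in_small e M r c f : 0 < e <= 1 -> expands_in r M c f ->
  expands_in (e * r) M c f /\
  forall n, \sum_(k < n) `|c k.+1| * (e * r) ^+ k.+1 <= e * M.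
Proof.
move=> /andP[e0 e1] cf; have [r0 cM fM] := cf; split.
  by apply: expands_inW cf => //; rewrite mulr_gt0//= ler_piMl// ltW.
move=> n; have := cM n.+1; rewrite big_ord_recl/= => cn.
apply: (@le_trans _ _ (e * \sum_(k < n) `|c k.+1| * r ^+ k.+1)); last first.
  apply: ler_wpM2l; first exact: ltW.
  by apply: le_trans cn; rewrite lerDr mulr_ge0.
rewrite mulr_sumr; apply: ler_sum => i _; rewrite mulrCA ler_wpM2l//.
rewrite exprMn ler_wpM2r ?exprn_ge0 ?(ltW r0)//.
by rewrite exprS ler_piMr ?(ltW e0)// exprn_ile1 ?(ltW e0).
Qed.

(** Terms of positive degree carry a factor of the radius, so their absolute sum can be made small.
    This keeps the recursions for inverses and square roots bounded. *)
Lemma expands_shrink c f e : 0 < e -> expands c f ->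
  exists r M, expands_in r M c f /\
    forall n, \sum_(k < n) `|c k.+1| * r ^+ k.+1 <= e.
Proof.
move=> e0 [r [M cf]]; have M0 := expands_in_ge0 cf.
pose d := Num.min 1 (e / (M + 1)).
have M1 : 0 < M + 1 by rewrite ltr_wpDl.
have d0 : 0 < d by rewrite lt_min ltr01 divr_gt0.
have d1 : d <= 1 by rewrite ge_min lexx.
have [|cf' ce] := @expands_in_small d M r c f _ cf; first by rewrite d0.
exists (d * r), M; split=> // n; apply: le_trans (ce n) _.
apply: (@le_trans _ _ (d * (M + 1))); first by rewrite ler_wpM2l ?lerDl// ltW.
by rewrite -ler_pdivlMr// ge_min lexx orbT.
Qed.

Lemma expandsV c f : c 0%N = 1 -> expands c f ->
  exists2 d, d 0%N = 1 & expands d (fun h => (f h)^-1).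
Proof.
move=> c0 cf; have [//|r [M [cfM ce]]] := @expands_shrink c f (2^-1) _ cf.
have M0 := expands_in_ge0 cfM; have [r0 cM fM] := cfM.
(* The equation [conv c d] = 1, solved for its coefficient of degree [n]. *)
have [d dE] : exists d, forall n, d n =
    if n is n'.+1 then - \sum_(i < n'.+1) c i.+1 * d (n' - i)%N else 1.
  apply: (@strong_rec (fun d n =>
    if n is n'.+1 then - \sum_(i < n'.+1) c i.+1 * d (n' - i)%N else 1)).
  move=> d d' [//|n] dd'; congr (- _); apply: eq_bigr => i _.
  by rewrite dd'// ltnS leq_subr.
have d0 : d 0%N = 1 by rewrite dE.
have cdE k : conv c d k = (k == 0)%:R.
  case: k => [|k]; rewrite /conv big_ord_recl/= c0 mul1r ?subn0.
    by rewrite big_ord0 d0 addr0.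
  by rewrite dE/= addrC; apply/eqP; rewrite subr_eq0; apply/eqP/eq_bigr => i _.
(* Since the tail of [c] has absolute sum at most 1/2, the sums S_n on the left satisfy S_(n+1) <= 1
   + S_n / 2 and so stay at most 2. *)
have dsum n : \sum_(k < n) `|d k| * r ^+ k <= 2.
  elim: n => [|n IHn]; first by rewrite big_ord0.
  rewrite big_ord_recl/= d0 normr1 expr0 mulr1 (_ : 2 = 1 + 2^-1 * 2); last by lra.
  rewrite lerD2l.
  apply: (@le_trans _ _ (\sum_(k < n) `|conv (fun k => c k.+1) d k| * r ^+ k * r)).
    by apply: ler_sum => i _; rewrite dE normrN exprSr mulrA.
  rewrite -mulr_suml.
  apply: (@le_trans _ _ ((\sum_(k < n) `|c k.+1| * r ^+ k) *
                         (\sum_(k < n) `|d k| * r ^+ k) * r)).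
    by apply: ler_wpM2r (conv_norm_le _ _ _ (ltW r0)); exact: ltW.
  rewrite mulrAC; apply: ler_pM => //.
  - by rewrite mulr_ge0 ?(ltW r0)// sumr_ge0// => i _; rewrite mulr_ge0// exprn_ge0// ltW.
  - by apply: sumr_ge0 => i _; rewrite mulr_ge0// exprn_ge0// ltW.
  apply: le_trans (ce n); rewrite mulr_suml; apply: ler_sum => i _.
  by rewrite exprSr mulrA.
exists d => //.
(* A second shrinking makes M |h| / r at most 1/2; then f >= 1/2 and its inverse is at most 2. *)
have [|cf'' _] := @expands_in_small (2 * (2 * M + 2))^-1 M r c f _ cfM.
  rewrite invr_gt0 mulr_gt0 ?ltr_wpDl ?mulr_ge0//=.
  rewrite invf_le1 ?mulr_gt0 ?ltr_wpDl ?mulr_ge0//; lra.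
have [s0 _ fM'] := cf''; set s := _ * r in s0 fM' cf''.
have sr : s <= r.
  rewrite /s ler_piMl ?(ltW r0)// invf_le1 ?mulr_gt0 ?ltr_wpDl ?mulr_ge0//; lra.
have f2 h : 0 < `|h| < s -> 2^-1 <= f h.
  move=> /andP[h0 hs].
  have hr : 0 < `|h| < r by rewrite h0 (lt_le_trans hs).
  have := fM h hr 1%N; rewrite big_ord_recl big_ord0/= c0 expr0 mulr1 addr0 expr1.
  have : M * (`|h| / r) <= 2^-1.
    apply: (@le_trans _ _ (M * (2 * (2 * M + 2))^-1)).
      apply: ler_wpM2l => //; rewrite ler_pdivrMr//; exact: ltW.
    rewrite ler_pdivrMr ?mulr_gt0 ?ltr_wpDl ?mulr_ge0//; lra.
  by move=> h1 /le_trans/(_ h1); rewrite ler_norml => /andP[]; lra.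
exists s, (2 * (M + M) * 2 + 2); split=> // [n|h hs n].
  apply: (@le_trans _ _ (\sum_(k < n) `|d k| * r ^+ k)); last first.
    by apply: le_trans (dsum n) _; rewrite lerDr !mulr_ge0// addr_ge0.
  apply: ler_sum => k _; apply: ler_wpM2l => //.
  by apply: lerXn2r => //; rewrite nnegrE ltW.
have /andP[h0 hs'] := hs.
have f0 := f2 h hs; have fh0 : 0 < f h by apply: lt_le_trans f0; lra.
have y0 : 0 <= (`|h| / s) ^+ n by rewrite exprn_ge0// divr_ge0// ltW.
case: n y0 => [_|n y0].
  rewrite big_ord0 subr0 expr0 mulr1 gtr0_norm ?invr_gt0//.
  have : (f h)^-1 <= 2 by rewrite -[2]invrK lef_pV2 ?posrE// invr_gt0; lra.
  by move/le_trans; apply; rewrite lerDr !mulr_ge0// addr_ge0.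
set D := \sum_(k < n.+1) _; pose A := \sum_(k < n.+1) c k * h ^+ k.
(* Two errors remain: that of truncating the Cauchy product [conv c d] = 1, and the remainder of
   f. *)
have -> : (f h)^-1 - D = (f h)^-1 * ((1 - A * D) - (f h - A) * D).
  by field; exact: lt0r_neq0.
have hr : `|h| <= r by rewrite (le_trans (ltW hs')).
have yle : (`|h| / r) ^+ n.+1 <= (`|h| / s) ^+ n.+1.
  apply: lerXn2r; rewrite ?nnegrE ?divr_ge0 ?(ltW r0) ?(ltW s0)//.
  by apply: ler_wpM2l => //; rewrite lef_pV2.
have y0r : 0 <= (`|h| / r) ^+ n.+1 by rewrite exprn_ge0// divr_ge0// ltW.
have S0 (e : nat -> R) j : 0 <= \sum_(k < j) `|e k| * r ^+ k.
  by apply: sumr_ge0 => k _; rewrite mulr_ge0// exprn_ge0// ltW.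
have D2 : `|D| <= 2.
  apply: le_trans (ler_norm_sum _ _ _) _; apply: le_trans (dsum n.+1).
  apply: ler_sum => k _; rewrite normrM normrX ler_wpM2l// lerXn2r ?nnegrE//.
  exact: ltW.
have AD : `|1 - A * D| <= (M * 2) * (`|h| / s) ^+ n.+1.
  have := conv_trunc_le c d n.+1 r0 hr.
  rewrite [in X in _ - X](eq_bigr (fun k : 'I_n.+1 => (k == 0 :> nat)%:R)); last first.
    by move=> [[|k] kn] _; rewrite cdE/= ?mul0r// expr0 mulr1.
  rewrite [in X in _ - X]big_ord_recl/= [in X in _ - X]big1// addr0 distrC.
  move=> /le_trans; apply.
  apply: ler_pM => //; first exact: (mulr_ge0 (S0 _ _) (S0 _ _)).
  by apply: ler_pM; [exact: S0|exact: S0|exact: cM|exact: dsum].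
rewrite normrM normfV (gtr0_norm fh0).
apply: (@le_trans _ _ (2 * ((M * 2) * (`|h| / s) ^+ n.+1 + M * (`|h| / s) ^+ n.+1 * 2))).
  apply: ler_pM => //.
  - by rewrite invr_ge0 ltW.
  - by rewrite -[2]invrK lef_pV2 ?posrE// invr_gt0; lra.
  apply: le_trans (ler_normB _ _) _; apply: lerD => //; rewrite normrM.
  apply: ler_pM => //; exact: fM'.
nra.
Qed.

Lemma expandsZ a c f : expands c f -> expands (fun k => a * c k) (fun h => a * f h).
Proof.
move=> [r [M cf]]; have M0 := expands_in_ge0 cf; case: cf => r0 cM fM.
exists r, (`|a| * M); split=> // [n|h hr n].
  apply: (@le_trans _ _ (`|a| * \sum_(k < n) `|c k| * r ^+ k)); last exact: ler_wpM2l.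
  by rewrite mulr_sumr ler_sum// => k _; rewrite normrM mulrA.
have -> : \sum_(k < n) a * c k * h ^+ k = a * \sum_(k < n) c k * h ^+ k.
  by rewrite mulr_sumr; apply: eq_bigr => k _; rewrite mulrA.
by rewrite -mulrBr normrM -mulrA ler_wpM2l// fM.
Qed.

Lemma expands_sqrt c f : c 0%N = 1 -> expands c f ->
  exists2 d, d 0%N = 1 & expands d (fun h => Num.sqrt (f h)).
Proof.
move=> c0 cf; have [//|r [M [cfM ce]]] := @expands_shrink c f (2^-1) _ cf.
have M0 := expands_in_ge0 cfM; have [r0 cM fM] := cfM.
(* The equation [conv d d = c], solved for the coefficient of highest index, which occurs twice. *)
pose F (d : nat -> R) n := if n is n'.+1
  then (c n'.+1 - \sum_(i < n') d i.+1 * d (n' - i)%N) / 2 else 1.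
have [d dE] : exists d, forall n, d n = F d n.
  apply: strong_rec => d d' [//|n] dd'; congr ((_ - _) / 2).
  by apply: eq_bigr => i _; rewrite !dd'// ltnS ?leq_subr.
have d0 : d 0%N = 1 by rewrite dE.
have ddE k : conv d d k = c k.
  case: k => [|k]; rewrite /conv big_ord_recl/= ?subn0.
    by rewrite big_ord0 d0 c0 addr0 mulr1.
  rewrite big_ord_recr/= d0 subnn d0 mul1r mulr1.
  under eq_bigr do rewrite subSS.
  by rewrite dE/F/=; lra.
have S0 (e : nat -> R) j : 0 <= \sum_(k < j) `|e k| * r ^+ k.
  by apply: sumr_ge0 => k _; rewrite mulr_ge0// exprn_ge0// ltW.
(* For the absolute sums t_n of the tail of [d] the recursion gives t_(n+1) <= (1/2 + t_n^2) / 2,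
   which preserves t_n <= 1/2. *)
have dsum1 n : \sum_(k < n) `|d k.+1| * r ^+ k.+1 <= 2^-1.
  elim: n => [|n IHn]; first by rewrite big_ord0.
  pose d1 k := d k.+1.
  pose e k : R := if k is k'.+1 then `|conv d1 d1 k'| else 0.
  have dle k : `|d k.+1| <= 2^-1 * (`|c k.+1| + e k).
    rewrite dE/F normrM mulrC (ger0_norm (_ : 0 <= 2^-1))//.
    apply: ler_wpM2l => //; apply: le_trans (ler_normB _ _) _; rewrite lerD2l.
    case: k => [|k]; first by rewrite big_ord0 normr0.
    rewrite le_eqVlt; apply/orP; left; apply/eqP; congr `|_|; apply: eq_bigr => i _.
    by rewrite /d1 subSn// -ltnS.
  apply: (@le_trans _ _ (2^-1 * (\sum_(k < n.+1) `|c k.+1| * r ^+ k.+1 +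
    \sum_(k < n) `|conv d1 d1 k| * r ^+ k.+2))).
    have -> : \sum_(k < n) `|conv d1 d1 k| * r ^+ k.+2 = \sum_(k < n.+1) e k * r ^+ k.+1.
      by rewrite [RHS]big_ord_recl/= mul0r add0r.
    rewrite -big_split/= mulr_sumr; apply: ler_sum => k _.
    by rewrite -mulrDl mulrA ler_wpM2r// exprn_ge0// ltW.
  have : \sum_(k < n) `|conv d1 d1 k| * r ^+ k.+2 <= 2^-1 * 2^-1.
    apply: (@le_trans _ _ ((\sum_(k < n) `|conv d1 d1 k| * r ^+ k) * r ^+ 2)).
      by rewrite mulr_suml ler_sum// => k _; rewrite -mulrA -exprD addn2.
    apply: (@le_trans _ _ (((\sum_(k < n) `|d1 k| * r ^+ k) * r) *
       ((\sum_(k < n) `|d1 k| * r ^+ k) * r))).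
      rewrite mulrACA -expr2; apply: ler_wpM2r; first by rewrite exprn_ge0// ltW.
      by apply: conv_norm_le; exact: ltW.
    have IH' : (\sum_(k < n) `|d1 k| * r ^+ k) * r <= 2^-1.
      apply: le_trans IHn; rewrite mulr_suml ler_sum// => k _.
      by rewrite exprSr mulrA.
    by apply: ler_pM => //; rewrite mulr_ge0// ltW.
  have := ce n.+1; lra.
have dsum n : \sum_(k < n) `|d k| * r ^+ k <= 2.
  case: n => [|n]; first by rewrite big_ord0.
  rewrite big_ord_recl/= d0 normr1 expr0 mulr1; have := dsum1 n; lra.
exists d => //.
exists r, (2 * (M + 4)); split=> // [n|h /[dup] hr0 /andP[h0 hr] n].
  by apply: le_trans (dsum n) _; lra.
have y0 : 0 <= (`|h| / r) ^+ n by rewrite exprn_ge0// divr_ge0// ltW.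
have fh : `|f h| <= M by have := fM h hr0 0%N; rewrite big_ord0 subr0 expr0 mulr1.
case: n y0 => [_|n y0].
  rewrite big_ord0 subr0 expr0 mulr1 ger0_norm ?sqrtr_ge0//.
  have s2 : Num.sqrt (f h) ^+ 2 <= M.
    have [fh0|fh0] := lerP 0 (f h).
      by rewrite sqr_sqrtr//; apply: le_trans fh; exact: ler_norm.
    by rewrite ltr0_sqrtr// expr0n.
  have := sqr_ge0 (Num.sqrt (f h) - 1); have := sqrtr_ge0 (f h); nra.
set S := \sum_(k < n.+1) _; pose A := \sum_(k < n.+1) c k * h ^+ k.
have S2 : 2^-1 <= S.
  rewrite /S big_ord_recl/= d0 expr0 mulr1.
  have : `|\sum_(i < n) d (bump 0 i) * h ^+ bump 0 i| <= 2^-1.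
    apply: le_trans (ler_norm_sum _ _ _) _; apply: le_trans (dsum1 n).
    apply: ler_sum => k _; rewrite normrM normrX ler_wpM2l// lerXn2r ?nnegrE// ltW//.
  by rewrite ler_norml => /andP[]; lra.
have AS : `|A - S * S| <= 4 * (`|h| / r) ^+ n.+1.
  have := conv_trunc_le d d n.+1 r0 (ltW hr).
  under [X in _ - X]eq_bigr do rewrite ddE.
  rewrite distrC => /le_trans; apply; apply: ler_wpM2r => //.
  rewrite (_ : 4 = 2 * 2); last by ring.
  by apply: ler_pM; [exact: S0|exact: S0|exact: dsum|exact: dsum].
have fA := fM _ hr0 n.+1; rewrite -/A in fA.
have fS : `|f h - S * S| <= (M + 4) * (`|h| / r) ^+ n.+1.
  rewrite mulrDl (_ : f h - S * S = (f h - A) + (A - S * S)); last by ring.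
  by apply: le_trans (ler_normD _ _) _; exact: lerD.
have s0 := sqrtr_ge0 (f h).
(* For f >= 0, divide f - S^2 by sqrt f + S >= 1/2. For f < 0 the square root is 0 by convention,
   and S >= 1/2 gives S <= 2 S^2 <= 2 |f - S^2|. *)
apply: (@le_trans _ _ (2 * `|f h - S * S|)); last by rewrite -mulrA ler_wpM2l.
have [fh0|fh0] := lerP 0 (f h).
  rewrite -{2}(sqr_sqrtr fh0) (_ : _ ^+ 2 - _ =
     (Num.sqrt (f h) - S) * (Num.sqrt (f h) + S)); last by ring.
  rewrite normrM mulrCA ler_peMr// ger0_norm; lra.
rewrite ltr0_sqrtr// sub0r normrN ger0_norm; last by lra.
rewrite ltr0_norm; nra.
Qed.

(** A positive constant term makes the class closed under products, inverses and square roots, hence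
    suited to the radicand and denominators of the Clebsch-Gordan coefficients. *)
Definition positive_expands f := exists2 c, 0 < c 0%N & expands c f.
Definition analytic f := exists c, expands c f.

Lemma conv0 c d : conv c d 0%N = c 0%N * d 0%N.
Proof. by rewrite /conv big_ord1. Qed.

Lemma positive_expandsM f g : positive_expands f -> positive_expands g ->
  positive_expands (fun h => f h * g h).
Proof.
move=> [c c0 cf] [d d0 dg]; exists (conv c d); last exact: expandsM.
by rewrite conv0 mulr_gt0.
Qed.

Lemma positive_expandsV f : positive_expands f ->
  positive_expands (fun h => (f h)^-1).
Proof.
move=> [c c0 cf].
have := @expandsV (fun k => (c 0%N)^-1 * c k) (fun h => (c 0%N)^-1 * f h).
case; [by rewrite mulVf// lt0r_neq0|exact: expandsZ|move=> d d0 dg].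
exists (fun k => (c 0%N)^-1 * d k); first by rewrite d0 mulr1 invr_gt0.
apply: expands_ext (expandsZ (c 0%N)^-1 dg) => h _.
by rewrite invfM invrK mulrA mulVf ?mul1r// lt0r_neq0.
Qed.

Lemma positive_expands_sqrt f : positive_expands f ->
  positive_expands (fun h => Num.sqrt (f h)).
Proof.
move=> [c c0 cf].
have := @expands_sqrt (fun k => (c 0%N)^-1 * c k) (fun h => (c 0%N)^-1 * f h).
case; [by rewrite mulVf// lt0r_neq0|exact: expandsZ|move=> d d0 dg].
exists (fun k => Num.sqrt (c 0%N) * d k); first by rewrite d0 mulr1 sqrtr_gt0.
apply: expands_ext (expandsZ (Num.sqrt (c 0%N)) dg) => h _.
by rewrite -sqrtrM ?(ltW c0)// mulrA divff ?mul1r// lt0r_neq0.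
Qed.

Lemma positive_analytic f : positive_expands f -> analytic f.
Proof. by case=> c _ cf; exists c. Qed.

Lemma analytic_ext f g : (forall h, h != 0 -> f h = g h) ->
  analytic f -> analytic g.
Proof. by move=> fg [c cf]; exists c; apply: expands_ext cf. Qed.

Lemma positive_expands_ext f g : (forall h, h != 0 -> f h = g h) ->
  positive_expands f -> positive_expands g.
Proof. by move=> fg [c c0 cf]; exists c => //; apply: expands_ext cf. Qed.

Lemma analyticD f g : analytic f -> analytic g -> analytic (fun h => f h + g h).
Proof. by move=> [c cf] [d dg]; exists (fun k => c k + d k); exact: expandsD. Qed.

Lemma analyticM f g : analytic f -> analytic g -> analytic (fun h => f h * g h).
Proof. by move=> [c cf] [d dg]; exists (conv c d); exact: expandsM. Qed.

Lemma analytic_cst a : analytic (fun=> a).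
Proof. by eexists; exact: expands_cst. Qed.

Lemma analyticB f g : analytic f -> analytic g -> analytic (fun h => f h - g h).
Proof.
move=> af ag; apply: analyticD af _; apply: analytic_ext (analyticM (analytic_cst (-1)) ag).
by move=> h _; rewrite mulN1r.
Qed.

Lemma positive_expands_cst a : 0 < a -> positive_expands (fun=> a).
Proof. by move=> a0; eexists; last exact: expands_cst. Qed.

Lemma analytic_sum (I : Type) (s : seq I) (P : pred I) (F : I -> R -> R) :
  (forall i, P i -> analytic (F i)) ->
  analytic (fun h => \sum_(i <- s | P i) F i h).
Proof.
move=> aF; elim: s => [|i s IHs].
  by apply: analytic_ext (analytic_cst 0) => h _; rewrite big_nil.
apply: (@analytic_ext (fun h => (if P i then F i h else 0) + \sum_(j <- s | P j) F j h)).
  by move=> h _; rewrite big_cons; case: ifP => //; rewrite add0r.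
by apply: analyticD => //; have := aF i; case: (P i) => [aFi|_]; [exact: aFi|exact: analytic_cst].
Qed.

Lemma positive_expands_prod (I : Type) (s : seq I) (F : I -> R -> R) :
  (forall i, positive_expands (F i)) ->
  positive_expands (fun h => \prod_(i <- s) F i h).
Proof.
move=> aF; elim: s => [|i s IHs].
  by apply: positive_expands_ext (positive_expands_cst ltr01) => h _; rewrite big_nil.
apply: (@positive_expands_ext (fun h => F i h * \prod_(j <- s) F j h)).
  by move=> h _; rewrite big_cons.
exact: positive_expandsM.
Qed.

Lemma expands_series M c (g : R -> R) : (forall n, \sum_(k < n) `|c k| <= M) ->
  (forall h, series (fun k => c k * h ^+ k) @ \oo --> g h)%classic ->
  expands c g.
Proof.
move=> cM cg; exists 1, M; split=> // [n|h /andP[h0 h1] n].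
  by apply: le_trans (cM n); apply: ler_sum => k _; rewrite expr1n mulr1.
rewrite divr1; set S := \sum_(k < n) _.
have cvS : ((fun N => `|series (fun k => c k * h ^+ k) N - S|) @ \oo --> `|g h - S|)%classic.
  by apply: cvg_norm; apply: cvgB (cg h) _; exact: cvg_cst.
apply: (cvgr_to_le cvS); exists n => // N /= nN.
have -> : S = series (fun k => c k * h ^+ k) n by rewrite /series/= big_mkord.
rewrite sub_series_geq//; apply: le_trans (ler_norm_sum _ _ _) _.
apply: (@le_trans _ _ (\sum_(n <= k < N) `|c k| * `|h| ^+ n)).
  rewrite big_nat_cond [leRHS]big_nat_cond; apply: ler_sum => k /andP[/andP[nk _] _].
  rewrite normrM normrX ler_wpM2l// -(subnK nk) exprD ler_piMl ?exprn_ge0//.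
  by rewrite exprn_ile1// ltW.
rewrite -mulr_suml ler_wpM2r ?exprn_ge0//.
apply: le_trans (cM N); rewrite -(big_mkord xpredT (fun k => `|c k|)).
by rewrite (big_cat_nat (leq0n n) nN)/= lerDr sumr_ge0.
Qed.

(** Majorization by the exponential series of |a| treats exp, cos and sin of a h alike. *)
Lemma expands_exp_type (a : R) c (g : R -> R) :
  (forall k, `|c k| <= `|a| ^+ k / k`!%:R) ->
  (forall h, series (fun k => c k * h ^+ k) @ \oo --> g h)%classic ->
  expands c g.
Proof.
move=> ca; apply: (@expands_series (expR `|a|)) => n.
apply: (@le_trans _ _ (series (exp_coeff `|a|) n)).
  rewrite /series/= big_mkord; apply: ler_sum => k _; exact: ca.
apply: nondecreasing_cvgn_le; last exact: is_cvg_series_exp_coeff.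
by apply: nondecreasing_series => k _ _; rewrite divr_ge0 ?exprn_ge0.
Qed.

Lemma expands_expR a : exists2 c, c 0%N = 1 & expands c (fun h => expR (a * h)).
Proof.
exists (fun k => a ^+ k / k`!%:R); first by rewrite expr0 divr1.
apply: (@expands_exp_type a) => [k|h].
  by rewrite normrM normrX normfV normr_nat.
rewrite /expR (_ : (fun k => _) = exp_coeff (a * h)); first exact: is_cvg_series_exp_coeff.
by apply/funext => k; rewrite /exp_coeff/= exprMn mulrAC.
Qed.

Lemma expands_cos a : exists2 c, c 0%N = 1 & expands c (fun h => cos (a * h)).
Proof.
exists (fun k => (~~ odd k)%:R * (-1) ^+ k./2 / k`!%:R * a ^+ k).
  by rewrite /= expr0 divr1 !mulr1.
apply: (@expands_exp_type a) => [k|h].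
  rewrite mulrC normrM normrX ler_wpM2l ?exprn_ge0//.
  rewrite normrM normfV normr_nat ler_piMl ?invr_ge0// normrM normr_nat normrX normrN1.
  by rewrite expr1n mulr1; case: odd.
rewrite (_ : (fun k => _) = cos_coeff (a * h)).
  rewrite unlock; exact: is_cvg_series_cos_coeff.
by rewrite cos_coeffE; apply/funext => k; rewrite exprMn mulrA.
Qed.

Lemma expands_sin a : exists2 c, c 0%N = 0 & expands c (fun h => sin (a * h)).
Proof.
exists (fun k => (odd k)%:R * (-1) ^+ k.-1./2 / k`!%:R * a ^+ k).
  by rewrite /= !mul0r.
apply: (@expands_exp_type a) => [k|h].
  rewrite mulrC normrM normrX ler_wpM2l ?exprn_ge0//.
  rewrite normrM normfV normr_nat ler_piMl ?invr_ge0// normrM normr_nat normrX normrN1.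
  by rewrite expr1n mulr1; case: odd.
rewrite (_ : (fun k => _) = sin_coeff (a * h)).
  rewrite unlock; exact: is_cvg_series_sin_coeff.
by rewrite sin_coeffE; apply/funext => k; rewrite exprMn mulrA.
Qed.

Lemma positive_expands_expR a : positive_expands (fun h => expR (a * h)).
Proof. by have [c c0 ce] := expands_expR a; exists c; rewrite ?c0. Qed.

End PowerSeries.

(** * Orders of vanishing at h = 0 *)

Section Orders.
Variable R : realType.
Implicit Types (f g : R -> R) (k l : int).

(** A growth bound instead of a condition on coefficients: it makes sense for the poles caused by q
    - q^-1, and it is additive under products without any expansion. *)
Definition ord_ge k f := exists r M, 0 < r /\
  forall h, 0 < `|h| < r -> `|f h| <= M * `|h| ^ k.

Lemma ord_geW l k f : l <= k -> ord_ge k f -> ord_ge l f.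
Proof.
move=> lk [r [M [r0 fM]]]; exists (Num.min r 1), (Num.max M 0); split.
  by rewrite lt_min r0 ltr01.
move=> h; rewrite lt_min => /and3P[h0 hr h1].
apply: le_trans (fM h _) _; first by rewrite h0.
apply: (@le_trans _ _ (Num.max M 0 * `|h| ^ k)).
  by rewrite ler_wpM2r ?exprz_ge0// le_max lexx.
rewrite ler_wpM2l ?le_max ?lexx ?orbT//.
rewrite -(subrK l k) expfzDr ?lt0r_neq0// ler_piMl ?exprz_ge0//.
by rewrite -subr_ge0 in lk; case: (k - l) lk => // j _; rewrite exprn_ile1// ltW.
Qed.

Lemma ord_ge_ext k f g : (forall h, h != 0 -> f h = g h) ->
  ord_ge k f -> ord_ge k g.
Proof.
move=> fg [r [M [r0 fM]]]; exists r, M; split=> // h /[dup] /andP[h0 _] /fM.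
by rewrite fg// -normr_gt0.
Qed.

Lemma ord_ge0 k : ord_ge k (fun=> 0).
Proof. by exists 1, 0; split=> // h _; rewrite normr0 mul0r. Qed.

Lemma ord_geD k f g : ord_ge k f -> ord_ge k g -> ord_ge k (fun h => f h + g h).
Proof.
move=> [r [M [r0 fM]]] [s [N [s0 gN]]].
exists (Num.min r s), (M + N); split; first by rewrite lt_min r0.
move=> h; rewrite lt_min => /and3P[h0 hr hs].
rewrite mulrDl; apply: le_trans (ler_normD _ _) _.
by apply: lerD; [apply: fM; rewrite h0|apply: gN; rewrite h0].
Qed.

Lemma ord_geM k l f g : ord_ge k f -> ord_ge l g ->
  ord_ge (k + l) (fun h => f h * g h).
Proof.
move=> [r [M [r0 fM]]] [s [N [s0 gN]]].
exists (Num.min r s), (M * N); split; first by rewrite lt_min r0.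
move=> h; rewrite lt_min => /and3P[h0 hr hs].
rewrite expfzDr ?lt0r_neq0// mulrACA normrM.
by apply: ler_pM => //; [apply: fM; rewrite h0|apply: gN; rewrite h0].
Qed.

Lemma ord_geN k f : ord_ge k f -> ord_ge k (fun h => - f h).
Proof.
by move=> [r [M [r0 fM]]]; exists r, M; split=> // h hr; rewrite normrN fM.
Qed.

Lemma ord_geB k f g : ord_ge k f -> ord_ge k g -> ord_ge k (fun h => f h - g h).
Proof. by move=> kf kg; apply: ord_geD kf _; exact: ord_geN. Qed.

Lemma analytic_ord f : analytic f -> ord_ge 0 f.
Proof.
move=> [c [r [M [r0 _ fM]]]]; exists r, M; split=> // h /fM/(_ 0%N).
by rewrite big_ord0 subr0.
Qed.

Lemma expands_ord1 c f : c 0%N = 0 -> expands c f -> ord_ge 1 f.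
Proof.
move=> c0 [r [M [r0 _ fM]]]; exists r, (M / r); split=> // h /fM/(_ 1%N).
by rewrite big_ord1 c0 mul0r subr0 expr1 mulrA mulrAC.
Qed.

(** By induction on the degree k: once the lower coefficients vanish, c_k h^k differs from f by
    O(h^(k+1)), and f itself is O(h^(k+1)); hence |c_k| <= K h for all small h > 0. *)
Lemma expands_coef_eq0 c f (N : nat) : expands c f -> ord_ge N f ->
  forall j, (j < N)%N -> c j = 0.
Proof.
move=> [r [M [r0 _ fM]]] [s [M' [s0 fM']]].
elim/(@ltn_ind) => k IHk kN; apply/eqP; rewrite -normr_le0; apply/ler_addgt0Pl => e e0.
rewrite addr0.
pose K := `|M'| + `|M| / r ^+ k.+1 + 1.
have K0 : 0 < K by rewrite ltr_wpDl// addr_ge0// divr_ge0// exprn_ge0// ltW.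
pose h := Num.min (Num.min (r / 2) (s / 2)) (Num.min 1 (e / K)).
have h0 : 0 < h by rewrite !lt_min ltr01 !divr_gt0.
have hr : h < r.
  apply: (@le_lt_trans _ _ (r / 2)); first by rewrite !ge_min lexx.
  by rewrite ltr_pdivrMr// ltr_pMr// ltr1n.
have hs : h < s.
  apply: (@le_lt_trans _ _ (s / 2)); first by rewrite !ge_min lexx orbT.
  by rewrite ltr_pdivrMr// ltr_pMr// ltr1n.
have h1 : h <= 1 by rewrite !ge_min lexx !orbT.
have he : K * h <= e by rewrite mulrC -ler_pdivlMr// !ge_min lexx !orbT.
have := fM h _ k.+1; rewrite gtr0_norm// h0 hr => /(_ isT).
rewrite big_ord_recr/= big1 => [|i _]; last by rewrite IHk ?mul0r// (ltn_trans _ kN).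
have := fM' h; rewrite gtr0_norm// h0 hs => /(_ isT) fN.
rewrite add0r => fk.
have : `|c k * h ^+ k| <= `|M'| * h ^+ k.+1 + `|M| / r ^+ k.+1 * h ^+ k.+1.
  rewrite (_ : c k * _ = f h - (f h - c k * h ^+ k)); last by ring.
  apply: le_trans (ler_normB _ _) _; apply: lerD.
    apply: le_trans fN _; apply: (@le_trans _ _ (`|M'| * h ^+ N)).
      by rewrite ler_wpM2r ?exprn_ge0 ?(ltW h0)// ler_norm.
    by rewrite ler_wpM2l// ler_wiXn2l// ltW.
  apply: le_trans fk _.
  rewrite expr_div_n mulrA mulrAC; apply: ler_wpM2r; first by rewrite exprn_ge0// ltW.
  by rewrite ler_wpM2r ?invr_ge0 ?exprn_ge0 ?(ltW r0)// ler_norm.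
rewrite -mulrDl normrM normrX (gtr0_norm h0) [h ^+ k.+1]exprS mulrA ler_pM2r ?exprn_gt0//.
move=> /le_trans; apply; apply: le_trans he; rewrite ler_pM2r// /K lerDl; lra.
Qed.

End Orders.

(** * Complex-valued functions of h, through their real and imaginary parts *)

Section ComplexValued.
Variable R : realType.
Local Open Scope complex_scope.
Implicit Types (f g : R -> R[i]) (k l : int).

Definition analyticC f :=
  analytic (fun h => complex.Re (f h)) /\ analytic (fun h => complex.Im (f h)).

Definition ordC_ge k f :=
  ord_ge k (fun h => complex.Re (f h)) /\ ord_ge k (fun h => complex.Im (f h)).

Lemma ReM (x y : R[i]) : complex.Re (x * y) =
  complex.Re x * complex.Re y - complex.Im x * complex.Im y.
Proof. by case: x y => [a b] [c d]. Qed.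

Lemma ImM (x y : R[i]) : complex.Im (x * y) =
  complex.Re x * complex.Im y + complex.Im x * complex.Re y.
Proof. by case: x y => [a b] [c d]. Qed.

Lemma ReD (x y : R[i]) : complex.Re (x + y) = complex.Re x + complex.Re y.
Proof. by case: x y => [a b] [c d]. Qed.

Lemma ImD (x y : R[i]) : complex.Im (x + y) = complex.Im x + complex.Im y.
Proof. by case: x y => [a b] [c d]. Qed.

Lemma analyticC_ext f g : (forall h, h != 0 -> f h = g h) ->
  analyticC f -> analyticC g.
Proof.
move=> fg [a b]; split; [apply: analytic_ext a|apply: analytic_ext b] => h h0;
by rewrite fg.
Qed.

Lemma ordC_ge_ext k f g : (forall h, h != 0 -> f h = g h) ->
  ordC_ge k f -> ordC_ge k g.
Proof.
move=> fg [a b]; split; [apply: ord_ge_ext a|apply: ord_ge_ext b] => h h0;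
by rewrite fg.
Qed.

Lemma ordC_geW l k f : l <= k -> ordC_ge k f -> ordC_ge l f.
Proof. by move=> lk [a b]; split; apply: ord_geW lk _. Qed.

Lemma analyticC_real (f : R -> R) : analytic f -> analyticC (fun h => (f h)%:C).
Proof. by move=> af; split=> //=; exact: analytic_cst. Qed.

Lemma analyticC_cst (z : R[i]) : analyticC (fun=> z).
Proof. by split; exact: analytic_cst. Qed.

Lemma ordC_ge_real k (f : R -> R) : ord_ge k f -> ordC_ge k (fun h => (f h)%:C).
Proof. by move=> af; split=> //=; exact: ord_ge0. Qed.

Lemma ordC_ge0 k : ordC_ge k (fun=> 0).
Proof. by split; exact: ord_ge0. Qed.

Lemma analyticC_ord f : analyticC f -> ordC_ge 0 f.
Proof. by case=> a b; split; exact: analytic_ord. Qed.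

Lemma analyticCD f g : analyticC f -> analyticC g -> analyticC (fun h => f h + g h).
Proof.
move=> [a b] [c d]; split.
  by apply: analytic_ext (analyticD a c) => h _; rewrite ReD.
by apply: analytic_ext (analyticD b d) => h _; rewrite ImD.
Qed.

Lemma ordC_geD k f g : ordC_ge k f -> ordC_ge k g -> ordC_ge k (fun h => f h + g h).
Proof.
move=> [a b] [c d]; split.
  by apply: ord_ge_ext (ord_geD a c) => h _; rewrite ReD.
by apply: ord_ge_ext (ord_geD b d) => h _; rewrite ImD.
Qed.

Lemma analyticCM f g : analyticC f -> analyticC g -> analyticC (fun h => f h * g h).
Proof.
move=> [a b] [c d]; split.
  by apply: analytic_ext (analyticB (analyticM a c) (analyticM b d)) => h _; rewrite ReM.
by apply: analytic_ext (analyticD (analyticM a d) (analyticM b c)) => h _; rewrite ImM.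
Qed.

Lemma ordC_geM k l f g : ordC_ge k f -> ordC_ge l g ->
  ordC_ge (k + l) (fun h => f h * g h).
Proof.
move=> [a b] [c d]; split.
  by apply: ord_ge_ext (ord_geB (ord_geM a c) (ord_geM b d)) => h _; rewrite ReM.
by apply: ord_ge_ext (ord_geD (ord_geM a d) (ord_geM b c)) => h _; rewrite ImM.
Qed.

Lemma analyticC_sum (I : Type) (s : seq I) (F : I -> R -> R[i]) :
  (forall i, analyticC (F i)) -> analyticC (fun h => \sum_(i <- s) F i h).
Proof.
move=> aF; elim: s => [|i s IHs].
  by apply: analyticC_ext (analyticC_cst 0) => h _; rewrite big_nil.
apply: analyticC_ext (analyticCD (aF i) IHs) => h _; by rewrite big_cons.
Qed.

Lemma ordC_ge_sum k (I : Type) (s : seq I) (F : I -> R -> R[i]) :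
  (forall i, ordC_ge k (F i)) -> ordC_ge k (fun h => \sum_(i <- s) F i h).
Proof.
move=> aF; elim: s => [|i s IHs].
  by apply: ordC_ge_ext (ordC_ge0 k) => h _; rewrite big_nil.
apply: ordC_ge_ext (ordC_geD (aF i) IHs) => h _; by rewrite big_cons.
Qed.

Lemma ordC_ge_prod n (F : nat -> R -> R[i]) :
  (forall i, (i < n)%N -> ordC_ge 1 (F i)) ->
  ordC_ge n (fun h => \prod_(i < n) F i h).
Proof.
elim: n => [|n IHn] F1.
  apply: (@ordC_ge_ext _ (fun=> 1)) => [h _|]; first by rewrite big_ord0.
  by apply: analyticC_ord; exact: analyticC_cst.
apply: (@ordC_ge_ext _ (fun h => (\prod_(i < n) F i h) * F n h)).
  by move=> h _; rewrite big_ord_recr.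
rewrite -addn1 PoszD; apply: ordC_geM; last exact: F1.
by apply: IHn => i ni; apply: F1; rewrite ltnS ltnW.
Qed.

Lemma analyticCX f n : analyticC f -> analyticC (fun h => f h ^+ n).
Proof.
move=> af; elim: n => [|n IHn].
  by apply: analyticC_ext (analyticC_cst 1) => h _; rewrite expr0.
by apply: analyticC_ext (analyticCM af IHn) => h _; rewrite exprS.
Qed.

End ComplexValued.

(** * Quantum integers, powers of q and Clebsch-Gordan coefficients at q = exp(h/2) *)

Section QuantumIntegers.
Variable R : realType.
Local Notation q h := (expR (h / 2) : R).

Lemma qpow_expR (x : rat) (h : R) : qpow (q h) x = expR (ratr x / 2 * h).
Proof. by rewrite /qpow/powR expR_eq0 expRK; congr expR; ring. Qed.

Lemma positive_qpow (x : rat) : positive_expands (fun h : R => qpow (q h) x).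
Proof.
by apply: positive_expands_ext (positive_expands_expR (ratr x / 2)) => h _; rewrite qpow_expR.
Qed.

Lemma qpowD (x y : rat) (h : R) :
  qpow (q h) (x + y) = qpow (q h) x * qpow (q h) y.
Proof. by rewrite !qpow_expR rmorphD -expRD -!mulrDl. Qed.

Lemma qpow0 (h : R) : qpow (q h) 0 = 1.
Proof. by rewrite qpow_expR rmorph0 !mul0r expR0. Qed.

Lemma qpow_nat (n : nat) (h : R) : qpow (q h) n%:R = q h ^+ n.
Proof. by rewrite qpow_expR ratr_nat -mulrA expRM_natl mulrC. Qed.

Lemma qpowN (x : rat) (h : R) : qpow (q h) (- x) = (qpow (q h) x)^-1.
Proof. by rewrite !qpow_expR rmorphN !mulNr expRN. Qed.

Lemma qpow_gt0 (x : rat) (h : R) : 0 < qpow (q h) x.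
Proof. by rewrite qpow_expR expR_gt0. Qed.

Lemma ord_qpow_sub (x y : rat) :
  ord_ge 1 (fun h : R => qpow (q h) x - qpow (q h) y).
Proof.
have [c c0 cE] := expands_expR (ratr x / 2 : R).
have [d d0 dE] := expands_expR (ratr y / 2 : R).
apply: (expands_ord1 _ (expands_ext _ (expandsD cE (expandsZ (-1) dE)))).
  by rewrite c0 d0 mulr1 subrr.
by move=> h _; rewrite !qpow_expR mulN1r.
Qed.

Lemma qdiff_neq0 (h : R) : h != 0 -> q h - (q h)^-1 != 0.
Proof.
move=> h0; have q0 := expR_gt0 (h / 2).
rewrite subr_eq0; apply/eqP => /(congr1 (fun x => x * expR (h / 2))).
rewrite mulVf ?lt0r_neq0// -expRD -splitr => /eqP.
by rewrite -expR0 (inj_eq (@expR_inj R)) (negbTE h0).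
Qed.

Lemma qint1 (h : R) : h != 0 -> qint (q h) 1 = 1.
Proof. by move=> h0; rewrite /qint !expr1 divff// qdiff_neq0. Qed.

(** This recursion avoids the denominator q - q^-1, which vanishes at h = 0. Positivity and
    expandability of [n+1] follow from it by induction. *)
Lemma qintS n (h : R) : h != 0 ->
  qint (q h) n.+1 = q h ^+ n + (q h)^-1 * qint (q h) n.
Proof.
move=> h0; rewrite /qint !exprS; have := qdiff_neq0 h0; have := expR_gt0 (h / 2).
set x := expR _ => x0 d0; have x1 : x ^+ n != 0 by rewrite expf_neq0// lt0r_neq0.
have x2 : x != 0 by rewrite lt0r_neq0.
by apply: (mulIf d0); rewrite divfK// mulrDl -!mulrA (mulVf d0) mulr1; field; rewrite x1.
Qed.

Lemma positive_qint n : positive_expands (fun h : R => qint (q h) n.+1).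
Proof.
elim: n => [|n [c c0 cq]].
  by apply: positive_expands_ext (positive_expands_cst ltr01) => h h0; rewrite qint1.
have [d d0 dq] : positive_expands (fun h : R => (q h)^-1 * qint (q h) n.+1).
  apply: positive_expandsM; last by exists c.
  apply: positive_expandsV; apply: positive_expands_ext (positive_qpow 1) => h _.
  by rewrite (qpow_nat 1) expr1.
have [e e0 eq] := positive_qpow n.+1%:R.
exists (fun k => e k + d k); first by rewrite addr_gt0.
apply: expands_ext (expandsD eq dq) => h h0.
by rewrite (qintS n.+1)// qpow_nat.
Qed.

Lemma positive_qfact x : positive_expands (fun h : R => qfact (q h) x).
Proof.
apply: (@positive_expands_ext _ (fun h : R =>
  \prod_(k <- iota 1 (Num.truncn x)) qint (q h) k.-1.+1)) => [h _|]; last first.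
  by apply: positive_expands_prod => k; exact: positive_qint.
rewrite /qfact /index_iota subn1/=; apply: eq_big_seq => k.
by rewrite mem_iota => /andP[k0 _]; rewrite prednK.
Qed.

(** [qfact] has a positive constant term at every rational argument, as [truncn] yields a natural
    number; only [2K+1] calls for a look at the conditions. *)
Lemma analytic_cg (I m J n K r : rat) : analytic (fun h : R => cg (q h) I m J n K r).
Proof.
rewrite /cg; have [cond|_] := boolP (cg_cond I m J n K r); last exact: analytic_cst.
apply: analyticM; last first.
  apply: analytic_sum => V _; apply: analyticM.
    apply: analyticM; last by apply/positive_analytic; exact: positive_qfact.
    apply: analyticM; last by apply/positive_analytic; exact: positive_qfact.
    apply: analyticM; [by apply/positive_analytic; exact: positive_qpow|exact: analytic_cst].
  apply/positive_analytic/positive_expandsV.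
  by do !apply: positive_expandsM; exact: positive_qfact.
apply: analyticM.
  by apply: analyticM; [by apply/positive_analytic; exact: positive_qpow|exact: analytic_cst].
apply/positive_analytic/positive_expands_sqrt; apply: positive_expandsM; last first.
  apply: positive_expandsV.
  by do !apply: positive_expandsM; exact: positive_qfact.
(* Since [0] = 0 has no positive constant term, 2K + 1 must be shown to truncate to a positive
   number. *)
have K0 : 0 <= K.
  case/andP: cond => _ /andP[/and3P[_ _ +] _]; exact: le_trans.
have [t tE] : exists t, Num.truncn (2 * K + 1) = t.+1.
  exists (Num.truncn (2 * K + 1)).-1; rewrite prednK//.
  by rewrite truncn_gt0 lerDr mulr_ge0.
rewrite tE; do 5 (apply: positive_expandsM; last exact: positive_qfact).
exact: positive_qint.
Qed.

Lemma analyticC_qcpow (z : R[i]) : analyticC (fun h : R => qcpow (q h) z).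
Proof.
rewrite /qcpow; apply: analyticCM.
  apply: analyticC_real; apply/positive_analytic.
  apply: positive_expands_ext (positive_expands_expR (complex.Re z / 2)) => h _.
  by rewrite expRK mulrC mulrA mulrAC.
split=> /=.
  have [c _ cs] := expands_cos (complex.Im z / 2); exists c; apply: expands_ext cs => h _.
  by rewrite expRK mulrC mulrA mulrAC.
have [c _ cs] := expands_sin (complex.Im z / 2); exists c; apply: expands_ext cs => h _.
by rewrite expRK mulrC mulrA mulrAC.
Qed.

Lemma qcpowD (z w : R[i]) (h : R) :
  qcpow (q h) (z + w) = qcpow (q h) z * qcpow (q h) w.
Proof.
rewrite /qcpow ReD ImD !mulrDr expRD cosD sinD rmorphM/= -!mulrA; congr (_ * _).
rewrite [RHS]mulrCA; congr (_ * _).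
by apply/eqP; rewrite eq_complex/=; apply/andP; split; apply/eqP; ring.
Qed.

Lemma qcpow0 (h : R) : qcpow (q h) 0 = 1.
Proof. by rewrite /qcpow/= !mulr0 expR0 cos0 sin0 mulr1. Qed.

Lemma qcpowMn (z : R[i]) n (h : R) :
  qcpow (q h) (z *+ n) = qcpow (q h) z ^+ n.
Proof. by elim: n => [|n IHn]; rewrite ?qcpow0// (mulrS z) qcpowD IHn exprS. Qed.

Lemma ordC_qpow_qcpow (x : rat) (z : R[i]) :
  ordC_ge 1 (fun h : R => 1 - (qpow (q h) x)%:C%C * qcpow (q h) z).
Proof.
pose a := ratr x / 2 + complex.Re z / 2; pose b := complex.Im z / 2.
have e h : (qpow (q h) x)%:C%C * qcpow (q h) z =
    (expR (a * h) * cos (b * h) +i* (expR (a * h) * sin (b * h)))%C.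
  rewrite qpow_expR /qcpow expRK mulrA -rmorphM/= -expRD.
  rewrite (_ : ratr x / 2 * h + h / 2 * complex.Re z = a * h); last by rewrite /a; ring.
  rewrite (_ : h / 2 * complex.Im z = b * h); last by rewrite /b; ring.
  by apply/eqP; rewrite eq_complex/= !mul0r subr0 addr0 !eqxx.
have [c c0 cE] := expands_expR a.
have [d d0 dE] := expands_cos b.
have [s s0 sE] := expands_sin b.
have [u u0 uE] : exists2 u : nat -> R, u 0%N = 1 & expands u (fun=> 1).
  by eexists; last exact: expands_cst.
split.
  apply: (expands_ord1 _ (expands_ext _ (expandsD uE (expandsZ (-1) (expandsM cE dE))))).
    by rewrite conv0 u0 c0 d0 !mulr1 subrr.
  by move=> h _; rewrite e mulN1r.
apply: (expands_ord1 _ (expands_ext _ (expandsZ (-1) (expandsM cE sE)))).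
  by rewrite conv0 s0 !mulr0.
by move=> h _; rewrite e/= sub0r mulN1r.
Qed.

End QuantumIntegers.

(** * Quantum numbers of rational argument and the q-binomial theorem *)

Section QuantumCalculus.
Variable R : realType.
Local Notation q h := (expR (h / 2) : R).
Implicit Types (h : R).

(** The quantum number [x] as a function of a rational variable. It is used at half-integral shifts,
    and its zero at x = 0 cuts off sums at their natural ends. *)
Definition qnum h (x : rat) : R :=
  (qpow (q h) x - qpow (q h) (- x)) / (q h - (q h)^-1).

Lemma qnum_nat h n : qnum h n%:R = qint (q h) n.
Proof. by rewrite /qnum qpowN qpow_nat. Qed.

Lemma qnumM h x y : qnum h x * qnum h y =
  (qpow (q h) (x + y) + qpow (q h) (- (x + y)) - qpow (q h) (x - y)
     - qpow (q h) (- (x - y))) / (q h - (q h)^-1) ^+ 2.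
Proof.
rewrite /qnum mulrACA -invfM -expr2; congr (_ / _).
have -> : - (x + y) = - x - y by ring.
have -> : - (x - y) = - x + y by ring.
by rewrite mulrBl !mulrBr -!qpowD; ring.
Qed.

Lemma qpow_qnum h x y : qpow (q h) x * qnum h y =
  (qpow (q h) (x + y) - qpow (q h) (x - y)) / (q h - (q h)^-1).
Proof. by rewrite /qnum mulrA mulrBr -!qpowD. Qed.

Lemma ord_qdiffV : ord_ge (-1) (fun h => (q h - (q h)^-1)^-1).
Proof.
exists 1, 2; split=> // h /andP[h0 h1].
have hn0 : h != 0 by rewrite -normr_gt0.
have -> : `|h| ^ (-1) = `|h|^-1 by [].
(* From exp t >= 1 + t: for h >= 0, q >= 1 + h/2 while q^-1 <= 1; the case h < 0 exchanges q and
   q^-1. *)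
suff t2 : `|h| / 2 <= `|q h - (q h)^-1|.
  rewrite normfV (_ : 2 * `|h|^-1 = (`|h| / 2)^-1); last by rewrite invfM invrK mulrC.
  by rewrite lef_pV2// posrE ?divr_gt0// normr_gt0 qdiff_neq0.
have e1 := expR_ge1Dx (h / 2); have e2 := expR_ge1Dx (- (h / 2)).
rewrite expRN in e2.
have qq : q h * (q h)^-1 = 1 by rewrite divff// lt0r_neq0// expR_gt0.
have := expR_gt0 (h / 2); have : 0 < (q h)^-1 by rewrite invr_gt0 expR_gt0.
move: e1 e2 qq; move: (expR (h / 2)) => x; move: x^-1 => y e1 e2 xy y0 x0.
have [h_ge0|h_lt0] := lerP 0 h.
  rewrite ger0_norm//; apply: le_trans (ler_norm _).
  have : y * 1 <= y * x by rewrite ler_wpM2l ?(ltW y0)//; lra.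
  lra.
rewrite ltr0_norm// -normrN; apply: le_trans (ler_norm _).
have : x * 1 <= x * y by rewrite ler_wpM2l ?(ltW x0)//; lra.
lra.
Qed.

Lemma qint_gt0 h k : h != 0 -> 0 < qint (q h) k.+1.
Proof.
move=> h0; elim: k => [|k IHk]; first by rewrite qint1.
rewrite (qintS k.+1)//; apply: addr_gt0; first by rewrite exprn_gt0 ?expR_gt0.
by rewrite mulr_gt0 ?invr_gt0 ?expR_gt0.
Qed.

Lemma qfact0 h : qfact (q h) 0 = 1.
Proof. by rewrite /qfact truncn0 big_geq. Qed.

Lemma qfactS h k : qfact (q h) k.+1%:R = qfact (q h) k%:R * qint (q h) k.+1.
Proof. by rewrite /qfact !natrK big_nat_recr. Qed.

Lemma qfact_gt0 h x : h != 0 -> 0 < qfact (q h) x.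
Proof.
move=> h0; rewrite /qfact big_nat_cond; apply: prodr_gt0 => -[//|k] _.
exact: qint_gt0.
Qed.

Lemma qfact_prodD h k d : h != 0 ->
  \prod_(i < d) qnum h (k%:R + i%:R + 1) = qfact (q h) (k + d)%:R / qfact (q h) k%:R.
Proof.
move=> h0; elim: d => [|d IHd].
  by rewrite big_ord0 addn0 divff// lt0r_neq0// qfact_gt0.
rewrite big_ord_recr/= IHd addnS qfactS -qnum_nat mulrAC; congr (_ * qnum h _ / _).
by rewrite -[in RHS]addn1 !natrD.
Qed.

Lemma qfact_prodB h k d : h != 0 -> (d <= k)%N ->
  \prod_(i < d) qnum h (k%:R - i%:R) = qfact (q h) k%:R / qfact (q h) (k - d)%:R.
Proof.
move=> h0; elim: d => [|d IHd] dk.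
  by rewrite big_ord0 subn0 divff// lt0r_neq0// qfact_gt0.
rewrite big_ord_recr/= IHd ?(ltnW dk)// -natrB ?(ltnW dk)// qnum_nat.
have -> : (k - d = (k - d.+1).+1)%N by rewrite subnSK.
rewrite qfactS; have := qfact_gt0 (k - d.+1)%:R h0; have := qint_gt0 (k - d.+1) h0.
by move=> /lt0r_neq0 a /lt0r_neq0 b; field; rewrite a b.
Qed.

Lemma qnum0 h : qnum h 0 = 0.
Proof. by rewrite /qnum oppr0 subrr mul0r. Qed.

Lemma qfact_prodB_eq0 h k d : (k < d)%N -> \prod_(i < d) qnum h (k%:R - i%:R) = 0.
Proof. by move=> kd; rewrite (bigD1 (Ordinal kd))//= subrr qnum0 mul0r. Qed.

(** By [coef_qpoly] its coefficients are, up to the factor [d]!, the factors (-1)^V q^(V(d+1)) /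
    ([V]! [d-V]!) of the Clebsch-Gordan sum with K = d and r = 0. With 'X read as a shift, the
    factorization shows a [d]-fold q-difference. *)
Definition qpoly h d : {poly R} :=
  \prod_(i < d) (1 - (qpow (q h) (2 * i.+1%:R))%:P * 'X).

Lemma qpolyS h d : qpoly h d.+1 = qpoly h d * (1 - (qpow (q h) (2 * d.+1%:R))%:P * 'X).
Proof. by rewrite /qpoly big_ord_recr. Qed.

Lemma coef_qpolyS h d k : (qpoly h d.+1)`_k =
  (qpoly h d)`_k - qpow (q h) (2 * d.+1%:R) * (if k is k'.+1 then (qpoly h d)`_k' else 0).
Proof.
rewrite qpolyS mulrBr mulr1 coefB mulrCA coefCM coefMX.
by case: k.
Qed.

Lemma size_qpoly h d : (size (qpoly h d) <= d.+1)%N.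
Proof.
elim: d => [|d IHd]; first by rewrite /qpoly big_ord0 size_poly1.
apply/leq_sizeP => -[//|k] dk; rewrite coef_qpolyS.
by rewrite !(leq_sizeP _ _ IHd) ?mulr0 ?subr0// ltnW.
Qed.

Lemma coef_qpoly h d k : h != 0 -> (k <= d)%N -> (qpoly h d)`_k =
  (-1) ^+ k * qpow (q h) (k%:R * (d%:R + 1)) * qfact (q h) d%:R
    / (qfact (q h) k%:R * qfact (q h) (d - k)%:R).
Proof.
move=> h0; elim: d k => [|d IHd] k.
  rewrite leqn0 => /eqP->; rewrite /qpoly big_ord0 coef1/= !qfact0 mul0r qpow0.
  by rewrite expr0 !mul1r invr1.
have n0 x : qfact (q h) x != 0 by rewrite lt0r_neq0// qfact_gt0.
have i0 j : qint (q h) j.+1 != 0 by rewrite lt0r_neq0// qint_gt0.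
rewrite coef_qpolyS leq_eqVlt => /orP[/eqP->|].
  rewrite (leq_sizeP _ _ (size_qpoly h d))// IHd// !subnn !qfact0 exprS.
  have -> : (d.+1%:R * (d.+1%:R + 1) : rat) = 2 * d.+1%:R + d%:R * (d%:R + 1).
    by rewrite -(addn1 d) natrD; ring.
  rewrite qpowD; field; by rewrite !n0.
rewrite ltnS => kd; rewrite IHd//; case: k kd => [_|k kd].
  rewrite mulr0 subr0 !subn0 !mul0r !qpow0 qfact0 expr0 !mul1r !divff//.
rewrite IHd 1?ltnW//.
have -> : (d - k = (d - k.+1).+1)%N by rewrite subnSK.
have -> : (d.+1 - k.+1 = (d - k.+1).+1)%N by rewrite subSS subnSK.
rewrite !qfactS.
(* The q-Pascal rule q^(k+1) [d+1] = [d-k] + q^(d+1) [k+1]. *)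
have key : qpow (q h) k.+1%:R * qint (q h) d.+1 =
    qint (q h) (d - k.+1).+1 + qpow (q h) d.+1%:R * qint (q h) k.+1.
  rewrite -!qnum_nat !qpow_qnum -mulrDl /qnum; congr (_ / _).
  have -> : ((d - k.+1).+1%:R : rat) = d%:R - k%:R by rewrite -subSn// subSS natrB// ltnW.
  rewrite !opprB -!(addn1 k) -!(addn1 d) !natrD.
  rewrite (_ : k%:R + 1 - (d%:R + 1) = k%:R - d%:R :> rat); last by ring.
  rewrite (_ : d%:R + 1 - (k%:R + 1) = d%:R - k%:R :> rat); last by ring.
  rewrite (addrC (d%:R + 1) (k%:R + 1)); ring.
have e1 : qpow (q h) (2 * d.+1%:R) * qpow (q h) (k%:R * (d%:R + 1)) =
    qpow (q h) (k.+1%:R * (d%:R + 1)) * qpow (q h) d.+1%:R.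
  by rewrite -!qpowD -!(addn1 d) -(addn1 k) !natrD; congr qpow; ring.
have e2 : qpow (q h) (k.+1%:R * (d.+1%:R + 1)) =
    qpow (q h) (k.+1%:R * (d%:R + 1)) * qpow (q h) k.+1%:R.
  by rewrite -!qpowD -!(addn1 d) -(addn1 k) !natrD; congr qpow; ring.
rewrite e2.
set a := qfact _ d%:R; set b := qfact _ k%:R; set c := qfact _ (d - k.+1)%:R.
set u := qpow _ (k.+1%:R * _) in e1 *; set v := qpow _ (_ * (d%:R + 1)) in e1 *.
have b0 : b != 0 by exact: n0.
have c0 : c != 0 by exact: n0.
move: (i0 (d - k.+1)%N) (i0 k) key; clearbody a b c u v.
move: (qint _ (d - k.+1).+1) (qint _ k.+1) (qint _ d.+1) => x y z x0 y0 key.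
transitivity ((-1) ^+ k.+1 * u * a / (b * c * x * y) * (x + qpow (q h) d.+1%:R * y)).
  rewrite mulrDr exprS.
  have e3 : qpow (q h) (2 * d.+1%:R) * ((-1) ^+ k * v * a / (b * (c * x)))
     = (u * qpow (q h) d.+1%:R) * ((-1) ^+ k * a / (b * (c * x))).
    by rewrite -e1; ring.
  by rewrite e3; field; rewrite b0 c0 x0 y0.
by rewrite -key; field; rewrite b0 c0 x0 y0.
Qed.

End QuantumCalculus.

(** * q-Hahn polynomials *)

Section QuantumSpan.
Variable R : realType.
Local Notation q h := (expR (h / 2) : R).
Implicit Types (h : R) (phi psi : R -> rat -> R).

(* A quantum analogue of polynomials in [x] of degree at most [n]: sums of
   [c(h) q^(e x)] with [c = O(h^(-n))]. *)
Inductive qspan (n : int) : (R -> rat -> R) -> Prop :=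
| qspan_monomial c e : ord_ge (- n) c -> qspan n (fun h x => c h * qpow (q h) (e * x))
| qspan_add phi psi : qspan n phi -> qspan n psi ->
    qspan n (fun h x => phi h x + psi h x)
| qspan_ext phi psi : (forall h, h != 0 -> phi h =1 psi h) ->
    qspan n phi -> qspan n psi.

Lemma qspanW n m phi : n <= m -> qspan n phi -> qspan m phi.
Proof.
move=> nm; elim=> [c e c_ord|f g _ mf _ mg|f g fg _ mf].
- by apply: qspan_monomial; apply: ord_geW c_ord; rewrite lerN2.
- exact: qspan_add.
- exact: qspan_ext mf.
Qed.

Lemma qspanM n m phi psi : qspan n phi -> qspan m psi ->
  qspan (n + m) (fun h x => phi h x * psi h x).
Proof.
move=> + mpsi; elim=> [c e c_ord|f g _ mf _ mg|f g fg _ mf].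
- elim: mpsi => [d u d_ord|f g _ mf _ mg|f g fg _ mf].
  + apply: (@qspan_ext _ (fun h x => (c h * d h) * qpow (q h) ((e + u) * x))).
      by move=> h _ x; rewrite mulrDl qpowD; ring.
    by apply: qspan_monomial; rewrite opprD; exact: ord_geM.
  + by apply: qspan_ext (qspan_add mf mg) => h _ x; rewrite mulrDr.
  + by apply: qspan_ext mf => h h0 x; rewrite fg.
- by apply: qspan_ext (qspan_add mf mg) => h _ x; rewrite mulrDl.
- by apply: qspan_ext mf => h h0 x; rewrite fg.
Qed.

Lemma qspan_cst n c : ord_ge (- n) c -> qspan n (fun h _ => c h).
Proof.
move=> /(@qspan_monomial _ _ 0); apply: qspan_ext => h _ x.
by rewrite mul0r qpow0 mulr1.
Qed.

Lemma qspanN n phi : qspan n phi -> qspan n (fun h x => - phi h x).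
Proof.
move=> nphi; have m1 : qspan 0 (fun _ _ => -1 : R).
  by apply: qspan_cst; apply: analytic_ord; exact: analytic_cst.
by have := qspanM m1 nphi; rewrite add0r; apply: qspan_ext => h _ x; rewrite mulN1r.
Qed.

Lemma qspanB n phi psi : qspan n phi -> qspan n psi ->
  qspan n (fun h x => phi h x - psi h x).
Proof. by move=> nphi npsi; apply: qspan_add => //; exact: qspanN. Qed.

(** On q^(e x) the operator is multiplication by 1 - q^(a+e), which is O(h) whatever [a] is. *)
Lemma qspan_qdiff n a phi : qspan n phi ->
  qspan (n - 1) (fun h x => phi h x - qpow (q h) a * phi h (x + 1)).
Proof.
elim=> [c e c_ord|f g _ mf _ mg|f g fg _ mf].
- apply: (@qspan_ext _ (fun h x => (c h * (qpow (q h) 0 - qpow (q h) (a + e))) *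
    qpow (q h) (e * x))).
    by move=> h _ x; rewrite (_ : e * (x + 1) = e * x + e) ?qpowD ?qpow0; ring.
  by apply: qspan_monomial; rewrite opprB addrC; apply: ord_geM => //; exact: ord_qpow_sub.
- by apply: qspan_ext (qspan_add mf mg) => h _ x; ring.
- by apply: qspan_ext mf => h h0 x; rewrite !fg.
Qed.

Lemma qspan_qnum a b : qspan 1 (fun h x => qnum h (a + b * x)).
Proof.
apply: (@qspan_ext _ (fun h x =>
    (qpow (q h) a / (q h - (q h)^-1)) * qpow (q h) (b * x) -
    (qpow (q h) (- a) / (q h - (q h)^-1)) * qpow (q h) (- b * x))).
  by move=> h _ x; rewrite /qnum opprD !qpowD mulNr; ring.
have o1 c : ord_ge (- 1) (fun h => qpow (q h) c / (q h - (q h)^-1)).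
  rewrite -[- 1]add0r; apply: ord_geM (@ord_qdiffV R).
  by apply/analytic_ord/positive_analytic; exact: positive_qpow.
by apply: qspanB; apply: qspan_monomial.
Qed.

(** The zero of the numerator cancels the pole, so quantum numbers independent of x do not raise the
    degree. *)
Lemma qspan_qnum_cst a : qspan 0 (fun h _ => qnum h a).
Proof.
apply: qspan_cst; rewrite oppr0 -[0](subrr 1); apply: ord_geM (@ord_qdiffV R).
exact: ord_qpow_sub.
Qed.

(* The ratio f_(k+d)(y + V) / f_k(y), where
   f_k(y) = [B+y]![C+k-y]! / ([B-y]![C-k+y]!). *)
Definition hahn_ratio h (B C k : rat) (d V : nat) (y : rat) : R :=
  \prod_(i < V) (qnum h (B + y + i%:R + 1) * qnum h (B - y - i%:R)) *
  \prod_(i < d - V) (qnum h (C + k - y + i%:R + 1) * qnum h (C - k + y - i%:R)).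

(* The Rodrigues formula for the q-Hahn polynomials: a [d]-fold q-difference
   of f_(k+d), divided by f_k. *)
Definition hahn h (B C k : rat) (d : nat) (y : rat) : R :=
  \sum_(V < d.+1) (qpoly h d)`_V * hahn_ratio h B C k d V y.

(** One elementary difference is split off: its summand 1 keeps [y], its shift ([hahn_ratio_move])
    leads to [y + 1]. In the notation of [hahn_ratio], the split-off factors are f_(k+1)(y) / f_k(y)
    and f_(k+1)(y+1) / f_k(y). *)
Lemma hahn_ratio_stay h B C k d V y : (V <= d)%N ->
  hahn_ratio h B C k d.+1 V y =
  hahn_ratio h B C (k + 1) d V y * (qnum h (C + k + 1 - y) * qnum h (C - k + y)).
Proof.
move=> Vd; rewrite /hahn_ratio subSn// big_ord_recl/= -[RHS]mulrA; congr (_ * _).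
rewrite [RHS]mulrC; congr (_ * _); first by congr (qnum h _ * qnum h _); ring.
apply: eq_bigr => i _; rewrite /bump/= natrD.
by congr (qnum h _ * qnum h _); ring.
Qed.

Lemma hahn_ratio_move h B C k d V y :
  hahn_ratio h B C k d.+1 V.+1 y =
  hahn_ratio h B C (k + 1) d V (y + 1) * (qnum h (B + y + 1) * qnum h (B - y)).
Proof.
rewrite /hahn_ratio subSS big_ord_recl/= [RHS]mulrC [RHS]mulrA; congr (_ * _).
  congr (_ * _); first by congr (qnum h _ * qnum h _); ring.
  apply: eq_bigr => i _; rewrite /bump/= natrD.
  by congr (qnum h _ * qnum h _); ring.
by apply: eq_bigr => i _; congr (qnum h _ * qnum h _); ring.
Qed.

Lemma hahnS h B C k d y : hahn h B C k d.+1 y =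
  hahn h B C (k + 1) d y * (qnum h (C + k + 1 - y) * qnum h (C - k + y))
  - qpow (q h) (2 * d.+1%:R) * hahn h B C (k + 1) d (y + 1)
    * (qnum h (B + y + 1) * qnum h (B - y)).
Proof.
rewrite /hahn; under eq_bigr do rewrite coef_qpolyS mulrBl.
rewrite big_split/=; congr (_ + _).
  rewrite big_ord_recr/= (leq_sizeP _ _ (size_qpoly h d))// mul0r addr0 mulr_suml.
  apply: eq_bigr => V _; rewrite -mulrA; congr (_ * _).
  by apply: hahn_ratio_stay; rewrite -ltnS.
rewrite big_ord_recl/= !mulr0 mul0r oppr0 add0r.
rewrite mulr_sumr mulr_suml -sumrN; apply: eq_bigr => V _.
by rewrite /bump/= add1n hahn_ratio_move !mulrA.
Qed.

(** Each product on the left has degree 2 in [y]. After [qnumM] the exponentials regroup into a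
    constant and [2y - k] [k + 1], which has degree 1. *)
Lemma qnumM_diff h B C k y :
  qnum h (C + k + 1 - y) * qnum h (C - k + y) - qnum h (B + y + 1) * qnum h (B - y)
  = qnum h (C - B) * qnum h (C + B + 1) + qnum h (- k + 2 * y) * qnum h (k + 1).
Proof.
rewrite !qnumM -mulrBl -mulrDl; congr (_ / _).
rewrite (_ : C + k + 1 - y + (C - k + y) = 2 * C + 1); last by ring.
rewrite (_ : C + k + 1 - y - (C - k + y) = 2 * k + 1 - 2 * y); last by ring.
rewrite (_ : B + y + 1 + (B - y) = 2 * B + 1); last by ring.
rewrite (_ : B + y + 1 - (B - y) = 2 * y + 1); last by ring.
rewrite (_ : C - B + (C + B + 1) = 2 * C + 1); last by ring.
rewrite (_ : C - B - (C + B + 1) = - (2 * B + 1)); last by ring.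
rewrite (_ : - k + 2 * y + (k + 1) = 2 * y + 1); last by ring.
rewrite (_ : - k + 2 * y - (k + 1) = - (2 * k + 1 - 2 * y)); last by ring.
by rewrite !opprK; ring.
Qed.

(* The leading terms of the two products in [hahnS] agree, so that each step
   raises the degree by one only. *)
Lemma qspan_hahn B C k (d : nat) : qspan d (fun h y => hahn h B C k d y).
Proof.
elim: d k => [|d IHd] k.
  apply: (@qspan_ext _ (fun _ _ => 1)).
    by move=> h _ y; rewrite /hahn big_ord1 /hahn_ratio/= !big_ord0 /qpoly big_ord0 coef1 !mulr1.
  by apply: qspan_cst; apply: analytic_ord; exact: analytic_cst.
pose v h y := qnum h (B + y + 1) * qnum h (B - y).
(* With u and v the two products in [hahnS] and H the polynomial of order d, H u - a H(y+1) v = H (u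
   - v) + (H - a H(y+1)) v. The degrees are d + 1 and (d - 1) + 2. *)
apply: (@qspan_ext _ (fun h y =>
  hahn h B C (k + 1) d y * (qnum h (C - B) * qnum h (C + B + 1) +
     qnum h (- k + 2 * y) * qnum h (k + 1)) +
  (hahn h B C (k + 1) d y - qpow (q h) (2 * d.+1%:R) * hahn h B C (k + 1) d (y + 1))
    * v h y)).
  by move=> h _ y; rewrite hahnS -qnumM_diff /v; ring.
apply: qspan_add.
  rewrite -addn1 PoszD; apply: qspanM => //; apply: qspan_add.
    apply: (@qspanW 0) => //; rewrite -[0]addr0.
    by apply: qspanM; exact: qspan_qnum_cst.
  rewrite -[Posz 1]addr0; apply: qspanM; last exact: qspan_qnum_cst.
  exact: qspan_qnum.
have -> : Posz d.+1 = (Posz d - 1) + (1 + 1) by rewrite -addn1 PoszD; ring.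
apply: qspanM; first exact: qspan_qdiff.
apply: qspanM; [apply: qspan_ext (qspan_qnum (B + 1) 1)|apply: qspan_ext (qspan_qnum B (-1))];
  by move=> h _ y; congr qnum; ring.
Qed.

(* The q-difference operator with symbol [qpoly h A] multiplies each of the
   exponentials in [phi] by [qpoly h A] evaluated at a point O(h)-close to 1. *)
Lemma ord_qpoly_qspan (A S : nat) n (C : rat) (p : R[i]) (F : R -> {poly R}) phi :
  (forall k, ord_ge 0 (fun h => (F h)`_k)) ->
  (forall h, (size (qpoly h A * F h)%R <= S)%N) -> (forall h, (size (F h) <= S)%N) ->
  qspan n phi ->
  ordC_ge (A%:Z - n) (fun h => \sum_(s < S)
    ((qpoly h A * F h)`_s)%:C%C * (phi h (s%:R - C))%:C%C
      * qcpow (q h) (2 * ratr (C - s%:R) * p)).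
Proof.
move=> F0 sG sF; elim=> [c e c_ord|f g _ mf _ mg|f g fg _ mf]; last 2 first.
- apply: ordC_ge_ext (ordC_geD mf mg) => h _; rewrite -big_split/=.
  by apply: eq_bigr => s _; rewrite (rmorphD (real_complex R))/= mulrDr mulrDl.
- by apply: ordC_ge_ext mf => h h0; apply: eq_bigr => s _; rewrite fg.
(* Raising [s] by 1 multiplies the exponentials of the summand by [w h]. Hence the sum is a multiple
   of the value of [qpoly h A * F h] at [w h], where the product splits; [S] covers both
   polynomials, so nothing is lost at the boundary. *)
pose w h := (qpow (q h) e)%:C%C * qcpow (q h) (- 2 * p).
apply: (@ordC_ge_ext _ _ (fun h => ((c h * qpow (q h) (- (e * C)))%:C%C *
    qcpow (q h) (2 * ratr C * p)) *
  ((\prod_(i < A) (1 - (qpow (q h) (2 * i.+1%:R))%:C%C * w h)) *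
   (\sum_(s < S) ((F h)`_s)%:C%C * w h ^+ s)))).
  move=> h h0.
  have -> : \sum_(s < S) ((F h)`_s)%:C%C * w h ^+ s = (map_poly (real_complex R) (F h)).[w h].
    rewrite (@horner_coef_wide _ S) ?size_map_poly//.
    by apply: eq_bigr => s _; rewrite coef_map.
  have -> : \prod_(i < A) (1 - (qpow (q h) (2 * i.+1%:R))%:C%C * w h) =
      (map_poly (real_complex R) (qpoly h A)).[w h].
    rewrite /qpoly rmorph_prod horner_prod; apply: eq_bigr => i _.
    by rewrite rmorphB rmorph1 rmorphM/= map_polyC map_polyX !hornerE.
  rewrite -hornerM -rmorphM/= (@horner_coef_wide _ S) ?size_map_poly// mulr_sumr.
  apply: eq_bigr => s _; rewrite coef_map/=.
  rewrite (_ : 2 * ratr (C - s%:R) * p = 2 * ratr C * p + (- 2 * p) *+ s); last first.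
    by rewrite rmorphB/= ratr_nat -[RHS]/(_ + _) -mulr_natr; ring.
  rewrite qcpowD qcpowMn /w exprMn -rmorphXn/=.
  have -> : qpow (q h) e ^+ s = qpow (q h) (e * s%:R).
    by elim: (s : nat) => [|t IHt]; rewrite ?mulr0 ?qpow0// exprS IHt -qpowD -addn1 natrD; congr qpow; ring.
  by rewrite mulrBr qpowD !rmorphM/=; ring.
have -> : A%:Z - n = (- n + 0) + (A%:Z + 0) by ring.
apply: ordC_geM.
  apply: ordC_geM; last by apply: analyticC_ord; exact: analyticC_qcpow.
  apply: ordC_ge_real; rewrite -[- n]addr0; apply: ord_geM => //.
  by apply/analytic_ord/positive_analytic; exact: positive_qpow.
apply: ordC_geM.
  apply: (@ordC_ge_prod _ A (fun i h => 1 - (qpow (q h) (2 * i.+1%:R))%:C%C * w h)) => i _.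
  apply: ordC_ge_ext (ordC_qpow_qcpow (2 * i.+1%:R + e) (- 2 * p)) => h _.
  by rewrite qpowD rmorphM/= -mulrA.
apply: ordC_ge_sum => s; rewrite -[0]addr0; apply: ordC_geM; first exact: ordC_ge_real.
apply/analyticC_ord/analyticCX/analyticCM; last exact: analyticC_qcpow.
by apply/analyticC_real/positive_analytic; exact: positive_qpow.
Qed.

End QuantumSpan.

(** * The coefficients Lambda *)

Section LambdaOrder.
Variable R : realType.
Local Notation q h := (expR (h / 2) : R).
Implicit Types (h : R).

Lemma truncn_max0B (a b : nat) :
  Num.truncn (Num.max 0 (a%:R - b%:R) : rat) = (a - b)%N.
Proof.
have [ab|ba] := leqP b a.
  by rewrite -natrB// max_r ?natrK.
rewrite max_l ?truncn0; last by rewrite subr_le0 ler_nat ltnW.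
by apply/esym/eqP; rewrite subn_eq0 ltnW.
Qed.

Lemma truncn_minn (a b : nat) :
  Num.truncn (Num.min a%:R b%:R : rat) = minn a b.
Proof.
by have [ab|ba] := leqP a b; [rewrite min_l ?natrK ?ler_nat|rewrite min_r ?natrK ?ler_nat// ltnW].
Qed.

(** Extends the limits of a Clebsch-Gordan sum, within which all factorials have natural arguments,
    to a full range 0..N on which the summand has been rewritten so as to vanish elsewhere. *)
Lemma sum_nat_ord (V : nmodType) (lo hi N : nat) (G H : nat -> V) :
  (hi <= N)%N -> (forall i, (lo <= i <= hi)%N -> G i = H i) ->
  (forall i, (i <= N)%N -> ~~ (lo <= i <= hi)%N -> H i = 0) ->
  \sum_(lo <= i < hi.+1) G i = \sum_(i < N.+1) H i.
Proof.
move=> hN GH H0; rewrite -(big_mkord xpredT H) [RHS](bigID (fun i => lo <= i <= hi)%N)/=.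
rewrite [X in _ + X]big1_seq ?addr0; last first.
  by move=> i /andP[Hi]; rewrite mem_index_iota ltnS => /andP[_ iN]; exact: H0.
rewrite [RHS](eq_bigr G); last by move=> i /GH.
have -> : \sum_(lo <= i < hi.+1) G i = \sum_(lo <= i < hi.+1 | (lo <= i <= hi)%N) G i.
  rewrite big_nat_cond [RHS]big_nat_cond; apply: eq_bigl => i; rewrite ltnS.
  by case: (_ <= _ <= _)%N.
rewrite -!(big_filter _ (fun i => lo <= i <= hi)%N); congr bigop.
apply: (irr_sorted_eq ltn_trans ltnn).
- by apply: sorted_filter; [exact: ltn_trans|exact: iota_ltn_sorted].
- by apply: sorted_filter; [exact: ltn_trans|exact: iota_ltn_sorted].
move=> i; rewrite !mem_filter !mem_index_iota !ltnS.
by case: (boolP (_ <= _ <= _)%N) => //= /andP[_ ih]; rewrite (leq_trans ih hN).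
Qed.

(** The part of the radicand at r = 0 that is free of sigma; the rest is [weight]. *)
Definition cg_norm h (I J K : rat) : R :=
  qint (q h) (Num.truncn (2 * K + 1)) * qfact (q h) (I + J - K) * qfact (q h) K
    * qfact (q h) K
  / (qfact (q h) (K + J - I) * qfact (q h) (I + K - J) * qfact (q h) (I + J + K + 1)).

Lemma positive_cg_norm I J (K : nat) :
  positive_expands (fun h => cg_norm h I J K%:R).
Proof.
rewrite /cg_norm (_ : 2 * K%:R + 1 = (2 * K)%N.+1%:R); last by rewrite -[RHS]natr1 natrM.
rewrite natrK; apply: positive_expandsM.
  do 3 (apply: positive_expandsM; last exact: positive_qfact).
  exact: positive_qint.
apply: positive_expandsV; do 2 (apply: positive_expandsM; last exact: positive_qfact).
exact: positive_qfact.
Qed.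

Lemma cg_norm_ge0 h I J (K : nat) : h != 0 -> 0 <= cg_norm h I J K%:R.
Proof.
move=> h0; rewrite /cg_norm (_ : 2 * K%:R + 1 = (2 * K)%N.+1%:R); last by rewrite -[RHS]natr1 natrM.
have f0 x := ltW (qfact_gt0 x h0); have i0 := ltW (qint_gt0 (2 * K)%N h0).
by rewrite natrK; move: (qint _ _) i0 => x x0; rewrite divr_ge0 ?mulr_ge0 ?f0.
Qed.

(* C = c/2 and B + C = e; the magnetic number sigma is C - s. *)
Variables c e : nat.
Let C : rat := c%:R / 2.
Let B : rat := e%:R - C.

(** |B - C| <= a <= B + C, written with B + C = e and C - B = c - e. *)
Definition triangle (a : nat) := [&& a <= e, c <= e + a & e <= c + a]%N.

(** |sigma| <= C and |sigma| <= B for sigma = C - s. *)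
Definition admissible s := [&& s <= c, s <= e & c <= e + s]%N.

(** The part of the radicand depending on sigma, the same in both coefficients. It equals 1 / f_0(s
    - C) in the notation of [hahn_ratio], so the product of the two square roots cancels the f_0
    left by the Rodrigues formula. *)
Definition weight h s : R :=
  qfact (q h) s%:R * qfact (q h) (e - s)%:R
   / (qfact (q h) (c - s)%:R * qfact (q h) (e + s - c)%:R).

(** The function that the first coefficient differentiates, stored as a coefficient sequence:
    multiplication by [qpoly h a] is then the [a]-fold q-difference. *)
Definition genpoly h a : {poly R} := \poly_(u < (e - a).+1)
  (qfact (q h) (c - u)%:R * qfact (q h) (e + a + u - c)%:R
   / (qfact (q h) u%:R * qfact (q h) (e - a - u)%:R)).

Lemma weight_gt0 h s : h != 0 -> 0 < weight h s.
Proof. by move=> h0; rewrite /weight divr_gt0// mulr_gt0// qfact_gt0. Qed.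

Ltac rat_nat := rewrite ?natrB; [rewrite ?natrD; lra|lia..].

(** The sum over V is a Cauchy product: some factors involve V alone, the others s - V alone. Beyond
    the limits either V > a or s - V > e - a, and a polynomial coefficient vanishes. *)
Lemma cg_sum_left h a s : h != 0 -> (c <= 2 * e)%N -> triangle a -> admissible s ->
  \sum_(Num.truncn (Num.max 0 (a%:R - B - (C - s%:R)))
          <= V < (Num.truncn (Num.min (a%:R - 0) (C - (C - s%:R)))).+1)
        (qpow (q h) (V%:R * (a%:R + 0 + 1)) * (-1) ^+ V
           * qfact (q h) (C + (C - s%:R) + V%:R) * qfact (q h) (B + a%:R - (C - s%:R) - V%:R)
         / (qfact (q h) V%:R * qfact (q h) (a%:R - 0 - V%:R)
              * qfact (q h) (C - (C - s%:R) - V%:R) * qfact (q h) (B - a%:R + (C - s%:R) + V%:R)))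
  = (qpoly h a * genpoly h a)`_s / qfact (q h) a%:R.
Proof.
move=> h0 ce /and3P[ae cea eca] /and3P[sc se ces].
have -> : a%:R - B - (C - s%:R) = (a + s)%:R - e%:R by rewrite natrD /B; lra.
have -> : C - (C - s%:R) = s%:R by lra.
rewrite subr0 truncn_max0B truncn_minn coefM mulr_suml.
apply: (sum_nat_ord (H := fun V => (qpoly h a)`_V * (genpoly h a)`_(s - V)
  / qfact (q h) a%:R)) => [|V /andP[Vlo Vhi]|V Vs VX]; first exact: geq_minr.
  rewrite leq_min in Vhi; have /andP[Va Vs] := Vhi.
  rewrite coef_qpoly// coef_poly ltnS (_ : (s - V <= e - a)%N); last by lia.
  have -> : C + (C - s%:R) + V%:R = (c - (s - V))%:R.
    by rewrite (_ : (c - (s - V) = (c + V) - s)%N) /C; [rat_nat|lia].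
  have -> : B + a%:R - (C - s%:R) - V%:R = (e + a + (s - V) - c)%:R.
    by rewrite (_ : (e + a + (s - V) - c = (e + a + s) - (c + V))%N) /B/C; [rat_nat|lia].
  have -> : a%:R - V%:R = (a - V)%:R :> rat by rewrite natrB.
  have -> : s%:R - V%:R = (s - V)%:R :> rat by rewrite natrB.
  have -> : B - a%:R + (C - s%:R) + V%:R = (e - a - (s - V))%:R.
    by rewrite (_ : (e - a - (s - V) = (e + V) - (a + s))%N) /B/C; [rat_nat|lia].
  rewrite ?addr0.
  have n0 x : qfact (q h) x != 0 by rewrite lt0r_neq0// qfact_gt0.
  move: (n0 a%:R) (n0 V%:R) (n0 (a - V)%:R) (n0 (s - V)%:R) (n0 (e - a - (s - V))%:R).
  move: (qfact _ a%:R) (qfact _ V%:R) (qfact _ (a - V)%:R) (qfact _ (s - V)%:R)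
    (qfact _ (e - a - (s - V))%:R) (qfact _ (c - (s - V))%:R)
    (qfact _ (e + a + (s - V) - c)%:R) (qpow _ _) ((-1) ^+ V).
  by move=> f1 f2 f3 f4 f5 f6 f7 x1 x2 *; field; do ?[apply/andP; split].
rewrite coef_poly; case: (leqP V a) => Va; last first.
  by rewrite (leq_sizeP _ _ (size_qpoly h a))// !mul0r.
rewrite ifF ?mulr0 ?mul0r//; apply/negbTE; move: VX; rewrite leq_min Va Vs !andbT; lia.
Qed.

(** Multiplication by the weight turns factorials into finite products of quantum numbers that make
    sense for all y. Beyond the limits either V > e - s or d - V > s, and a product meets [0]. *)
Lemma cg_sum_right h d s : h != 0 -> (c <= 2 * e)%N -> triangle d -> admissible s ->
  weight h s *
  \sum_(Num.truncn (Num.max 0 (d%:R - C - - (C - s%:R)))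
          <= V < (Num.truncn (Num.min (d%:R - 0) (B - - (C - s%:R)))).+1)
        (qpow (q h) (V%:R * (d%:R + 0 + 1)) * (-1) ^+ V
           * qfact (q h) (B + - (C - s%:R) + V%:R) * qfact (q h) (C + d%:R - - (C - s%:R) - V%:R)
         / (qfact (q h) V%:R * qfact (q h) (d%:R - 0 - V%:R)
              * qfact (q h) (B - - (C - s%:R) - V%:R) * qfact (q h) (C - d%:R + - (C - s%:R) + V%:R)))
  = hahn h B C 0 d (s%:R - C) / qfact (q h) d%:R.
Proof.
move=> h0 ce /and3P[de ced ecd] /and3P[sc se ces].
have -> : d%:R - C - - (C - s%:R) = d%:R - s%:R by lra.
have -> : B - - (C - s%:R) = (e - s)%:R by rewrite natrB// /B; lra.
rewrite subr0 truncn_max0B truncn_minn mulr_sumr /hahn mulr_suml.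
have ratioE V : hahn_ratio h B C 0 d V (s%:R - C) =
  (\prod_(i < V) qnum h ((e + s - c)%:R + i%:R + 1)) * (\prod_(i < V) qnum h ((e - s)%:R - i%:R)) *
  ((\prod_(i < d - V) qnum h ((c - s)%:R + i%:R + 1)) * \prod_(i < d - V) qnum h (s%:R - i%:R)).
  rewrite /hahn_ratio -!big_split/=; congr (_ * _); apply: eq_bigr => i _;
    congr (qnum h _ * qnum h _); rewrite ?natrB ?natrD /B/C; (lra || lia).
apply: (sum_nat_ord (H := fun V => (qpoly h d)`_V * hahn_ratio h B C 0 d V (s%:R - C)
  / qfact (q h) d%:R)) => [|V /andP[Vlo Vhi]|V Vd VX]; first exact: geq_minl.
  rewrite leq_min in Vhi; have /andP[Vd Vs] := Vhi.
  have V4 : (d - V <= s)%N by lia.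
  rewrite ratioE (qfact_prodD (e + s - c) V h0) (qfact_prodB h0 Vs).
  rewrite (qfact_prodD (c - s) (d - V) h0) (qfact_prodB h0 V4).
  rewrite coef_qpoly// /weight.
  have -> : B + - (C - s%:R) + V%:R = (e + s - c + V)%:R.
    by rewrite (_ : (e + s - c + V = (e + s + V) - c)%N) /B/C; [rat_nat|lia].
  have -> : C + d%:R - - (C - s%:R) - V%:R = (c - s + (d - V))%:R.
    by rewrite (_ : (c - s + (d - V) = (c + d) - (s + V))%N) /B/C; [rat_nat|lia].
  have -> : d%:R - V%:R = (d - V)%:R :> rat by rewrite natrB.
  have -> : (e - s)%:R - V%:R = (e - s - V)%:R :> rat by rewrite [RHS]natrB.
  have -> : C - d%:R + - (C - s%:R) + V%:R = (s - (d - V))%:R.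
    by rewrite (_ : (s - (d - V) = (s + V) - d)%N) /B/C; [rat_nat|lia].
  rewrite ?addr0.
  have n0 x : qfact (q h) x != 0 by rewrite lt0r_neq0// qfact_gt0.
  move: (n0 d%:R) (n0 V%:R) (n0 (d - V)%:R) (n0 s%:R) (n0 (e - s)%:R) (n0 (c - s)%:R)
    (n0 (e + s - c)%:R) (n0 (e - s - V)%:R) (n0 (s - (d - V))%:R).
  move: (qfact _ d%:R) (qfact _ V%:R) (qfact _ (d - V)%:R) (qfact _ s%:R) (qfact _ (e - s)%:R)
    (qfact _ (c - s)%:R) (qfact _ (e + s - c)%:R) (qfact _ (e - s - V)%:R)
    (qfact _ (s - (d - V))%:R) (qfact _ (e + s - c + V)%:R)
    (qfact _ (c - s + (d - V))%:R) (qpow _ _) ((-1) ^+ V).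
  by move=> f1 f2 f3 f4 f5 f6 f7 f8 f9 f10 f11 x1 x2 *; field; do ?[apply/andP; split].
have {VX} : (e - s < V)%N || (s < d - V)%N by move: VX; rewrite leq_min Vd; lia.
by rewrite ratioE => /orP[] /qfact_prodB_eq0 ->; rewrite !mulr0 ?mul0r ?mulr0 ?mul0r.
Qed.

Lemma half_integer_half (k : nat) : half_integer (k%:R / 2).
Proof. by rewrite /half_integer mulrC divfK ?natr_int. Qed.

Lemma cg_cond_admissible a s : (c <= 2 * e)%N -> triangle a -> admissible s ->
  cg_cond C (C - s%:R) B (- (C - s%:R)) a%:R 0 /\
  cg_cond B (- (C - s%:R)) C (C - s%:R) a%:R 0.
Proof.
move=> ce /and3P[ae cea eca] /and3P[sc se ces].
have hC : half_integer C by exact: half_integer_half.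
have hB : half_integer B.
  rewrite (_ : B = (2 * e - c)%:R / 2); first exact: half_integer_half.
  by rewrite natrB// natrM /B /C; lra.
have ha : half_integer a%:R.
  by rewrite (_ : a%:R = (2 * a)%:R / 2); [exact: half_integer_half|rewrite natrM; lra].
have i1 : C - (C - s%:R) \is a Num.int by rewrite (_ : _ - _ = s%:R) ?natr_int//; lra.
have i2 : B - - (C - s%:R) \is a Num.int.
  by rewrite (_ : _ - _ = (e - s)%:R) ?natr_int// natrB// /B; lra.
have i3 : (a%:R : rat) - 0 \is a Num.int by rewrite subr0 natr_int.
have i4 : C + B + a%:R \is a Num.int.
  by rewrite (_ : _ + _ = (e + a)%:R) ?natr_int// natrD /B; lra.
have i5 : B + C + a%:R \is a Num.int by rewrite (addrC B).
move: ce ae cea eca sc se ces.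
rewrite -!(ler_nat rat) natrM !natrD => ce ae cea eca sc se ces.
have s0 : 0 <= s%:R :> rat by rewrite ler0n.
have a0 : 0 <= a%:R :> rat by rewrite ler0n.
have b1 : `|C - s%:R| <= C by rewrite ler_norml /C; apply/andP; split; lra.
have b2 : `|- (C - s%:R)| <= B by rewrite ler_norml /B/C; apply/andP; split; lra.
have b3 : `|C - B| <= a%:R <= C + B.
  by rewrite ler_norml /B/C; apply/andP; split; [apply/andP; split|]; lra.
have b4 : `|B - C| <= a%:R <= B + C by rewrite distrC (addrC B).
by rewrite /cg_cond hC hB ha i1 i2 i3 i4 i5 b1 b2 b3 b4 normr0 a0 subrr addNr eqxx.
Qed.

Lemma cg_not_admissible a s : (s <= c)%N -> ~~ admissible s -> forall h,
  cg (q h) C (C - s%:R) B (- (C - s%:R)) a 0 = 0.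
Proof.
move=> sc + h; rewrite /admissible sc/= => bad; rewrite /cg ifF//; apply/negbTE.
apply: contra bad => /and3P[_ /and3P[_ + _] _].
rewrite normrN ler_norml -!(ler_nat rat) natrD /B /C => /andP[b1 b2].
by apply/andP; split; lra.
Qed.

Lemma cg_left h a s : h != 0 -> (c <= 2 * e)%N -> triangle a -> admissible s ->
  cg (q h) C (C - s%:R) B (- (C - s%:R)) a%:R 0 =
  qpow (q h) (C - s%:R + (B * (B + 1) - C * (C + 1) - a%:R * (a%:R + 1)) / 2)
  * (-1) ^+ s * (Num.sqrt (cg_norm h C B a%:R) * Num.sqrt (weight h s))
  * ((qpoly h a * genpoly h a)`_s / qfact (q h) a%:R).
Proof.
move=> h0 ce ta gs; rewrite /cg (cg_cond_admissible ce ta gs).1 cg_sum_left//.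
have /and3P[ae cea eca] := ta; have /and3P[sc se ces] := gs.
have E1 : C - (C - s%:R) = s%:R by lra.
have E2 : B - - (C - s%:R) = (e - s)%:R by rewrite natrB// /B; lra.
have E3 : C + (C - s%:R) = (c - s)%:R by rewrite natrB// /C; lra.
have E4 : B + - (C - s%:R) = (e + s - c)%:R by rewrite natrB// natrD /B/C; lra.
rewrite E1 E2 E3 E4 natrK ?subr0 ?addr0 ?add0r mulr1.
congr (_ * _ * _ * _); rewrite -sqrtrM ?cg_norm_ge0//; congr Num.sqrt.
rewrite /cg_norm /weight.
have n0 x : qfact (q h) x != 0 by rewrite lt0r_neq0// qfact_gt0.
move: (n0 (a%:R + B - C)) (n0 (C + a%:R - B)) (n0 (C + B + a%:R + 1)) (n0 (c - s)%:R)
  (n0 (e + s - c)%:R).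
move: (qfact _ (a%:R + B - C)) (qfact _ (C + a%:R - B)) (qfact _ (C + B + a%:R + 1))
  (qfact _ (c - s)%:R) (qfact _ (e + s - c)%:R) (qfact _ s%:R) (qfact _ (e - s)%:R)
  (qfact _ a%:R) (qfact _ (C + B - a%:R)) (qint _ _).
by move=> f1 f2 f3 f4 f5 f6 f7 f8 f9 f10 *; field; do ?[apply/andP; split].
Qed.

Lemma cg_right h d s : h != 0 -> (c <= 2 * e)%N -> triangle d -> admissible s ->
  cg (q h) B (- (C - s%:R)) C (C - s%:R) d%:R 0 * weight h s =
  qpow (q h) (- (C - s%:R) + (C * (C + 1) - B * (B + 1) - d%:R * (d%:R + 1)) / 2)
  * (-1) ^+ (e - s) * (Num.sqrt (cg_norm h B C d%:R) * Num.sqrt (weight h s))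
  * (hahn h B C 0 d (s%:R - C) / qfact (q h) d%:R).
Proof.
move=> h0 ce td gs; rewrite -(cg_sum_right h0 ce td gs) (mulrC (weight h s)) [RHS]mulrA.
congr (_ * weight h s); rewrite /cg (cg_cond_admissible ce td gs).2; congr (_ * _).
have /and3P[de ced ecd] := td; have /and3P[sc se ces] := gs.
have E1 : C - (C - s%:R) = s%:R by lra.
have E2 : B - - (C - s%:R) = (e - s)%:R by rewrite natrB// /B; lra.
have E3 : C + (C - s%:R) = (c - s)%:R by rewrite natrB// /C; lra.
have E4 : B + - (C - s%:R) = (e + s - c)%:R by rewrite natrB// natrD /B/C; lra.
rewrite E1 E2 E3 E4 natrK ?subr0 ?addr0 ?add0r mulr1.
congr (_ * _ * _); rewrite -sqrtrM ?cg_norm_ge0//; congr Num.sqrt.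
rewrite /cg_norm /weight.
have n0 x : qfact (q h) x != 0 by rewrite lt0r_neq0// qfact_gt0.
move: (n0 (d%:R + C - B)) (n0 (B + d%:R - C)) (n0 (B + C + d%:R + 1)) (n0 (c - s)%:R)
  (n0 (e + s - c)%:R).
move: (qfact _ (d%:R + C - B)) (qfact _ (B + d%:R - C)) (qfact _ (B + C + d%:R + 1))
  (qfact _ (c - s)%:R) (qfact _ (e + s - c)%:R) (qfact _ s%:R) (qfact _ (e - s)%:R)
  (qfact _ d%:R) (qfact _ (B + C - d%:R)) (qint _ _).
by move=> f1 f2 f3 f4 f5 f6 f7 f8 f9 f10 *; field; do ?[apply/andP; split].
Qed.

End LambdaOrder.

(** * Summation over sigma and the order of Lambda *)

Section LambdaOrderBound.
Variable R : realType.
Local Notation q h := (expR (h / 2) : R).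
Implicit Types (h : R).

Lemma size_genpoly c e h a : (size (genpoly c e h a : {poly R})%R <= (e - a).+1)%N.
Proof. exact: size_poly. Qed.

Lemma size_qpoly_genpoly c e h a : (a <= e)%N ->
  (size (qpoly h a * genpoly c e h a : {poly R})%R <= e.+1)%N.
Proof.
move=> ae; apply: leq_trans (size_polyMleq _ _) _.
have := size_qpoly h a; have := size_genpoly c e h a.
by move: (size _) (size _) => x y; lia.
Qed.

Lemma ord_genpoly c e a k : ord_ge 0 (fun h => (genpoly c e h a : {poly R})`_k).
Proof.
apply: (@ord_ge_ext _ _ (fun h => if (k < (e - a).+1)%N then
  (qfact (q h) (c - k)%:R * qfact (q h) (e + a + k - c)%:R
   / (qfact (q h) k%:R * qfact (q h) (e - a - k)%:R)) else 0)).
  by move=> h _; rewrite /genpoly coef_poly.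
case: (_ < _)%N; last exact: ord_ge0.
apply/analytic_ord/positive_analytic/positive_expandsM.
  by apply: positive_expandsM; exact: positive_qfact.
by apply/positive_expandsV/positive_expandsM; exact: positive_qfact.
Qed.

Lemma prod_ord_eq0 n i (F : nat -> R) : (i < n)%N -> F i = 0 -> \prod_(j < n) F j = 0.
Proof. by move=> ni Fi; rewrite (bigD1 (Ordinal ni))//= Fi mul0r. Qed.

(** The polynomial in [Lambda_sum] has coefficients at non-admissible [s] too. There every term of
    [hahn] contains [0]: the two products have d pairs of factors altogether, and the triangle
    condition on d prevents both from stopping short of the zero. *)
Lemma hahn_outside c e d s h : (s <= e)%N -> triangle c e d -> ~~ admissible c e s ->
  hahn h (e%:R - c%:R / 2) (c%:R / 2) 0 d (s%:R - c%:R / 2) = 0 :> R.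
Proof.
move=> se /and3P[de ced ecd] bad; rewrite /hahn big1// => -[V /= Vd] _.
rewrite /hahn_ratio; set y := s%:R - _.
pose F i := qnum h (e%:R - c%:R / 2 + y + i%:R + 1) * qnum h (e%:R - c%:R / 2 - y - i%:R).
pose G i := qnum h (c%:R / 2 + 0 - y + i%:R + 1) * qnum h (c%:R / 2 - 0 + y - i%:R).
suff [zF|zG] : \prod_(i < V) F i = 0 \/ \prod_(i < d - V) G i = 0.
- by rewrite [X in _ * (X * _)]zF mul0r mulr0.
- by rewrite [X in _ * (_ * X)]zG !mulr0.
have [sc|sc] := leqP s c.
  have {bad}ces : (e + s < c)%N by move: bad; rewrite /admissible sc se/= -ltnNge.
  have [Vc|Vc] := ltnP (c - (e + s + 1)) V.
    left; apply: (@prod_ord_eq0 _ (c - (e + s + 1)) F) => //.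
    rewrite /F (_ : _ + 1 = 0) ?qnum0 ?mul0r// /y natrB ?natrD; [lra|lia].
  right; apply: (@prod_ord_eq0 _ s G); first by lia.
  by rewrite /G (_ : _ - s%:R = 0) ?qnum0 ?mulr0// /y; lra.
have [Vc|Vc] := ltnP (s - (c + 1)) (d - V).
  right; apply: (@prod_ord_eq0 _ (s - (c + 1)) G) => //.
  rewrite /G (_ : _ + 1 = 0) ?qnum0 ?mul0r// /y natrB ?natrD; [lra|lia].
left; apply: (@prod_ord_eq0 _ (e - s) F); first by lia.
by rewrite /F (_ : _ - (e - s)%:R = 0) ?qnum0 ?mulr0// /y natrB//; lra.
Qed.

(** Most of the dependence on sigma cancels: q^sigma against q^(-sigma), the square roots of the
    weight against the weight, and the signs combine to (-1)^e. The bound c + e dominates both the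
    range s <= c of [mags] and the degree bound e. *)
Lemma Lambda_sum (p : R[i]) (c e a d : nat) h :
  h != 0 -> (c <= 2 * e)%N -> triangle c e a -> triangle c e d ->
  Lambda (q h) p (e%:R - c%:R / 2) (c%:R / 2) a%:R d%:R =
  (qpow (q h) (((e%:R - c%:R / 2) * (e%:R - c%:R / 2 + 1) - c%:R / 2 * (c%:R / 2 + 1)
      - a%:R * (a%:R + 1)) / 2) *
   qpow (q h) ((c%:R / 2 * (c%:R / 2 + 1) - (e%:R - c%:R / 2) * (e%:R - c%:R / 2 + 1)
      - d%:R * (d%:R + 1)) / 2) * (-1) ^+ e *
   (Num.sqrt (cg_norm h (c%:R / 2) (e%:R - c%:R / 2) a%:R) *
    Num.sqrt (cg_norm h (e%:R - c%:R / 2) (c%:R / 2) d%:R)) /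
   (qfact (q h) a%:R * qfact (q h) d%:R))%:C%C *
  \sum_(s < (c + e).+1) ((qpoly h a * genpoly c e h a)`_s)%:C%C *
     (hahn h (e%:R - c%:R / 2) (c%:R / 2) 0 d (s%:R - c%:R / 2))%:C%C *
     qcpow (q h) (2 * ratr (c%:R / 2 - s%:R) * p).
Proof.
move=> h0 ce ta td; have /and3P[ae cea eca] := ta.
pose C : rat := c%:R / 2; pose B : rat := e%:R - C.
rewrite -/C -/B; set K := (X in X%:C%C * _).
pose T s := ((qpoly h a * genpoly c e h a)`_s)%:C%C * (hahn h B C 0 d (s%:R - C))%:C%C *
  qcpow (q h) (2 * ratr (C - s%:R) * p).
rewrite /Lambda /mags (_ : Num.truncn (2 * C) = c); last first.
  by rewrite /C mulrC divfK// natrK.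
(* [mags] lists sigma = t - C; the reversal s = c - t gives sigma = C - s. *)
rewrite big_map -[iota 0 c.+1]/(index_iota 0 c.+1) big_mkord (reindex_inj rev_ord_inj)/=.
rewrite mulr_sumr.
have T0 s : ~~ admissible c e s -> T s = 0.
  move=> bad; rewrite /T; have [se|se] := leqP s e.
    by rewrite hahn_outside// mulr0 mul0r.
  by rewrite (leq_sizeP _ _ (size_qpoly_genpoly c h ae)) ?mul0r.
have -> : \sum_(i < (c + e).+1) K%:C%C * T i = \sum_(i < c.+1) K%:C%C * T i.
  rewrite (big_ord_widen _ (fun s => K%:C%C * T s) (_ : c.+1 <= (c + e).+1)%N); last by lia.
  rewrite [RHS]big_mkcond; apply: eq_bigr => s _; case: ifP => // /negbT sc.
  by rewrite T0 ?mulr0// /admissible; move: sc; rewrite ltnS => /negbTE ->.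
apply: eq_bigr => -[s /=]; rewrite ltnS => sc _.
rewrite subSS natrB// (_ : c%:R - s%:R - C = C - s%:R); last by rewrite /C; lra.
have [gs|bad] := boolP (admissible c e s); last first.
  by rewrite T0// mulr0 cg_not_admissible// !mul0r.
rewrite mulrAC -rmorphM /T mulrA -!rmorphM; congr (_%:C%C * _).
have w0 := lt0r_neq0 (weight_gt0 c e s h0).
have := cg_left h0 ce ta gs; have := cg_right h0 ce td gs; rewrite -/C -/B => G2 G1.
apply: (mulIf w0); rewrite -[LHS]mulrA G2 G1.
have e1 : (-1) ^+ s * (-1) ^+ (e - s) = (-1) ^+ e :> R.
  by rewrite -exprD subnKC//; case/and3P: gs.
have e2 := sqr_sqrtr (ltW (weight_gt0 c e s h0)).
rewrite !(qpowD (C - s%:R)) !(qpowD (- (C - s%:R))) qpowN /K -/C -/B -e1 -[X in _ = _ * X]e2.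
have := qpow_gt0 (C - s%:R) h => /lt0r_neq0.
have := lt0r_neq0 (qfact_gt0 a%:R h0); have := lt0r_neq0 (qfact_gt0 d%:R h0).
move: (qfact _ a%:R) (qfact _ d%:R) (qpow _ (C - s%:R)) (Num.sqrt (weight _ _ _ _)).
move: (Num.sqrt _) (Num.sqrt _) (qpow _ _) (qpow _ _) (_`_s) (hahn _ _ _ _ _ _).
by move=> x1 x2 x3 x4 x5 x6 x7 x8 x9 x10 *; field; do ?[apply/andP; split].
Qed.

Lemma cg_cond_params (B C s : rat) (a d : nat) :
  cg_cond C s B (- s) a%:R 0 -> cg_cond B (- s) C s d%:R 0 ->
  exists c e : nat, [/\ C = c%:R / 2, B = e%:R - c%:R / 2, (c <= 2 * e)%N,
    triangle c e a & triangle c e d].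
Proof.
case/and5P=> /and3P[hC _ _] /and3P[sC sB _] /and3P[i1 i2 _] _ /andP[/andP[tA1 tA2] _].
case/and5P=> _ _ _ _ /andP[/andP[tD1 tD2] _].
have C0 : 0 <= C := le_trans (normr_ge0 _) sC.
have B0 : 0 <= B := le_trans (normr_ge0 _) sB.
have /natrP[c cE] : 2 * C \is a Num.nat by rewrite natrEint mulr_ge0 ?andbT.
have /natrP[e eE] : C + B \is a Num.nat.
  rewrite natrEint addr_ge0// andbT (_ : C + B = (C - s) + (B - - s)); last by lra.
  exact: rpredD.
have CE : C = c%:R / 2 by rewrite -cE; lra.
have BE : B = e%:R - c%:R / 2 by rewrite -CE -eE; lra.
exists c, e; split=> //.
- by rewrite -(ler_nat rat) natrM; lra.
- by move: tA1; rewrite ler_norml => /andP[? ?]; apply/and3P; split;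
    rewrite -(ler_nat rat) ?natrD; lra.
by move: tD1; rewrite ler_norml => /andP[? ?]; apply/and3P; split;
  rewrite -(ler_nat rat) ?natrD; lra.
Qed.

Lemma ord_Lambda (p : R[i]) (B C : rat) (a d : nat) :
  ordC_ge (a%:Z - d%:Z) (fun h => Lambda (q h) p B C a%:R d%:R).
Proof.
(* If no sigma meets both conditions, Lambda is 0. Otherwise a single one yields the integrality and
   triangle conditions, which do not depend on sigma. *)
have [/hasP[s _ /andP[c1 c2]]|none] := boolP (has (fun s =>
  cg_cond C s B (- s) a%:R 0 && cg_cond B (- s) C s d%:R 0) (mags C)); last first.
  apply: ordC_ge_ext (ordC_ge0 R _) => h _; rewrite /Lambda big1_seq// => s /andP[_ sC].
  have := hasPn none s sC; rewrite negb_and => /orP[] /negbTE c0.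
    by rewrite {1}/cg c0 !mul0r.
  by rewrite [X in _ * X%:C%C]/cg c0 mulr0.
have [c [e [CE BE ce ta td]]] := cg_cond_params c1 c2.
have /and3P[ae _ _] := ta.
rewrite CE BE.
apply: ordC_ge_ext => [h h0|]; first by rewrite (Lambda_sum p h0 ce ta td).
rewrite -[a%:Z - _]add0r; apply: ordC_geM.
  apply: ordC_ge_real; apply: analytic_ord.
  have pf := @positive_qfact R; have pq := @positive_qpow R.
  apply: analyticM; last first.
    by apply/positive_analytic/positive_expandsV/positive_expandsM; exact: pf.
  apply: analyticM; last first.
    by apply/positive_analytic/positive_expandsM; apply: positive_expands_sqrt;
      exact: positive_cg_norm.
  apply: analyticM; last exact: analytic_cst.
  by apply/positive_analytic/positive_expandsM; exact: pq.
apply: ord_qpoly_qspan (qspan_hahn R _ _ _ _) => [k|h|h]; first exact: ord_genpoly.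
- by apply: leq_trans (size_qpoly_genpoly c h ae) _; rewrite ltnS leq_addl.
- by apply: leq_trans (size_genpoly c e h a) _; rewrite ltnS; lia.
Qed.

Lemma analyticC_Lambda (p : R[i]) (A B C D : rat) :
  analyticC (fun h => Lambda (q h) p B C A D).
Proof.
apply: analyticC_sum => s; apply: analyticCM.
  apply: analyticCM; last exact: analyticC_qcpow.
  by apply: analyticC_real; exact: analytic_cg.
by apply: analyticC_real; exact: analytic_cg.
Qed.

End LambdaOrderBound.

(** * The state sum *)

Section OperatorOrders.
Variables (R : realType) (p : R[i]).
Local Notation q h := (expR (h / 2) : R).
Local Open Scope complex_scope.

Definition bidx_upto (L : nat) : seq bidx :=
  undup (flatten [seq [seq existT (fun b => 'I_(b.*2.+1)) b t | t <- enum 'I_(b.*2.+1)]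
                 | b <- iota 0 L]).

Lemma mem_bidx_upto L (x : bidx) : (tag x < L)%N -> x \in bidx_upto L.
Proof.
case: x => b t /= bL; rewrite mem_undup; apply/flatten_mapP; exists b.
  by rewrite mem_iota.
by apply: map_f; rewrite mem_enum.
Qed.

Lemma app_bounded L (T : oper R) (u : vect R) y :
  (forall x, (L <= tag x)%N -> u x = 0) ->
  app T u y = \sum_(x <- bidx_upto L) u x * T x y.
Proof.
move=> uL; rewrite /app (fsbigE (bidx_upto L)) ?undup_uniq//.
  by apply: eq_bigl => x; rewrite in_setT.
move=> x _ xL; rewrite uL ?mul0r// leqNgt.
by apply: contra xL; exact: mem_bidx_upto.
Qed.

(** The invariant along the path: support bounded uniformly in h, which makes [app] a finite sum,
    and a component of order beta at spin beta. *)
Definition spin_bounded (u : R -> vect R) :=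
  (exists L, forall h x, (L <= tag x)%N -> u h x = 0) /\
  (forall x : bidx, analyticC (fun h => u h x) /\ ordC_ge (tag x)%:Z (fun h => u h x)).

Definition ord_vect (k : nat) (u : R -> vect R) :=
  forall x, ordC_ge k%:Z (fun h => u h x).

(** Entries that lower the spin are only granted a negative order by the second bound; analyticity
    adds order 0, so that an order once gained is kept on the way back to spin 0. *)
Definition spin_controlled (T : R -> oper R) :=
  (exists K, forall h (x y : bidx), (K + tag x < tag y)%N -> T h x y = 0) /\
  (forall x y : bidx, analyticC (fun h => T h x y) /\
     ordC_ge ((tag y)%:Z - (tag x)%:Z) (fun h => T h x y)).

Lemma app_spin_bounded T u : spin_controlled T -> spin_bounded u ->
  spin_bounded (fun h => app (T h) (u h)).
Proof.
move=> [[K TK] TP] [[L uL] uP]; split.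
  exists (K + L)%N => h y KLy; rewrite (app_bounded _ _ (uL h)) big1_seq// => x _.
  have [xL|xL] := leqP L (tag x); first by rewrite uL// mul0r.
  by rewrite TK ?mulr0// (leq_trans _ KLy)// ltn_add2l.
move=> y; split.
  apply: (analyticC_ext (f := fun h => \sum_(x <- bidx_upto L) u h x * T h x y)).
    by move=> h _; rewrite (app_bounded _ _ (uL h)).
  by apply: analyticC_sum => x; apply: analyticCM; [case: (uP x)|case: (TP x y)].
apply: (ordC_ge_ext (f := fun h => \sum_(x <- bidx_upto L) u h x * T h x y)).
  by move=> h _; rewrite (app_bounded _ _ (uL h)).
apply: ordC_ge_sum => x.
rewrite (_ : (tag y)%:Z = (tag x)%:Z + ((tag y)%:Z - (tag x)%:Z)); last by ring.
by apply: ordC_geM; [case: (uP x)|case: (TP x y)].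
Qed.

Lemma app_ord_vect k T u : spin_controlled T -> spin_bounded u -> ord_vect k u ->
  ord_vect k (fun h => app (T h) (u h)).
Proof.
move=> [_ TP] [[L uL] _] uk y.
apply: (ordC_ge_ext (f := fun h => \sum_(x <- bidx_upto L) u h x * T h x y)).
  by move=> h _; rewrite (app_bounded _ _ (uL h)).
apply: ordC_ge_sum => x; rewrite -[k%:Z]addr0; apply: ordC_geM => //.
by apply: analyticC_ord; case: (TP x y).
Qed.

Lemma opX_controlled alpha i j : spin_controlled (fun=> opX R alpha i j).
Proof.
have same x y : tag x != tag y -> opX R alpha i j x y = 0.
  rewrite /opX /ket /bspin; apply: contra_neq_eq; rewrite mulf_eq0 negb_or.
  rewrite !pnatr_eq0 !eqb0 !negbK => /andP[/andP[/eqP-> _] /andP[+ _]].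
  by rewrite eqr_nat => /eqP.
split; first by exists 0%N => _ x y; rewrite add0n => xy; rewrite same// ltn_eqF.
move=> x y; split; first exact: analyticC_cst.
have [xy|xy] := eqVneq (tag x) (tag y); last first.
  by apply: ordC_ge_ext (ordC_ge0 R _) => h _; rewrite same.
by rewrite xy subrr; apply: analyticC_ord; exact: analyticC_cst.
Qed.

(** X(alpha) reads only components of spin alpha, which are O(h^alpha) by the invariant. *)
Lemma opX_ord_vect k alpha i j u : k%:R <= alpha -> spin_bounded u ->
  ord_vect k (fun h => app (opX R alpha i j) (u h)).
Proof.
move=> ka [[L uL] uP] y.
apply: (ordC_ge_ext (f := fun h => \sum_(x <- bidx_upto L) u h x * opX R alpha i j x y)).
  by move=> h _; rewrite (app_bounded _ _ (uL h)).
apply: ordC_ge_sum => x; have [ax|ax] := eqVneq alpha (bspin x); last first.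
  apply: ordC_ge_ext (ordC_ge0 R _) => h _.
  by rewrite /opX (negbTE ax)/= mul0r mulr0.
rewrite -[k%:Z]addr0; apply: ordC_geM; last by apply: analyticC_ord; exact: analyticC_cst.
apply: ordC_geW (proj2 (uP x)).
by move: ka; rewrite ax /bspin ler_nat lez_nat.
Qed.

Lemma opG_controlled : spin_controlled (fun h => opG (q h)).
Proof.
have same h x y : tag x != tag y -> opG (q h) x y = 0.
  rewrite /opG /ket /bspin; apply: contra_neq_eq; rewrite mulf_eq0 negb_or.
  rewrite pnatr_eq0 eqb0 negbK => /andP[_ /andP[+ _]].
  by rewrite eqr_nat => /eqP.
have aG x y : analyticC (fun h => opG (q h) x y).
  apply: analyticCM; last exact: analyticC_cst.
  by apply: analyticC_real; apply: positive_analytic; exact: positive_qpow.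
split; first by exists 0%N => h x y; rewrite add0n => xy; rewrite same// ltn_eqF.
move=> x y; split; first exact: aG.
have [xy|xy] := eqVneq (tag x) (tag y); last first.
  by apply: ordC_ge_ext (ordC_ge0 R _) => h _; rewrite same.
by rewrite xy subrr; exact: analyticC_ord.
Qed.

Lemma spins_upto_le x s : s \in spins_upto x -> 0 <= s <= `|x|.
Proof.
case/mapP => t; rewrite mem_iota add0n ltnS => /andP[_ tx] ->.
rewrite divr_ge0//= ler_pdivrMr// mulrC.
have [x0|x0] := lerP 0 x.
  rewrite ger0_norm//; apply: (le_trans (y := (Num.truncn (2 * x))%:R)).
    by rewrite ler_nat.
  by rewrite truncn_le ?mulr_ge0.
move: tx; rewrite (_ : Num.truncn (2 * x) = 0%N); first by rewrite leqn0 => /eqP ->; rewrite mulr_ge0.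
by apply/eqP; rewrite -leqn0 leqNgt truncn_gt0 -ltNge; lra.
Qed.

Lemma opg_controlled alpha i j : spin_controlled (fun h => opg (q h) p alpha i j).
Proof.
split.
  (* From D <= |alpha| + beta and gamma <= |alpha| + D, the spin rises by at most 2 |alpha|. *)
  exists (Num.truncn (2 * `|alpha|)).+1 => h x y xy; rewrite /opg.
  apply: big1_seq => D /andP[_ /spins_upto_le/andP[D0 Dle]].
  apply: big1_seq => g /andP[_ /spins_upto_le/andP[g0 gle]].
  apply: big1_seq => l _; apply: big1_seq => z _.
  rewrite /ket [_ == g]gt_eqF ?andFb ?mulr0//.
  have a1 : 2 * `|alpha| < (Num.truncn (2 * `|alpha|)).+1%:R.
    by rewrite truncnS_gt.
  have b1 : (Num.truncn (2 * `|alpha|)).+1%:R + bspin x < bspin y.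
    by rewrite /bspin -natrD ltr_nat.
  have c1 := ler_normD alpha (bspin x); have c2 := ler_normD alpha D.
  rewrite (ger0_norm D0) in c2; rewrite (ger0_norm (_ : 0 <= bspin x)) ?ler0n// in c1.
  by lra.
move=> x y.
have term D g l z : analyticC (fun h =>
    (cg (q h) g l alpha i D z)%:C * (cg (q h) alpha j (bspin x) (bmag x) D z)%:C
      * Lambda (q h) p alpha D g (bspin x) * ket R g l y) /\
  ordC_ge ((tag y)%:Z - (tag x)%:Z) (fun h =>
    (cg (q h) g l alpha i D z)%:C * (cg (q h) alpha j (bspin x) (bmag x) D z)%:C
      * Lambda (q h) p alpha D g (bspin x) * ket R g l y).
  have acg : analyticC (fun h => (cg (q h) g l alpha i D z)%:C *
      (cg (q h) alpha j (bspin x) (bmag x) D z)%:C).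
    by apply: analyticCM; apply: analyticC_real; exact: analytic_cg.
  split.
    apply: analyticCM; last exact: analyticC_cst.
    by apply: analyticCM => //; exact: analyticC_Lambda.
  (* The ket forces gamma to be the spin of [y], a natural number, as [ord_Lambda] requires. *)
  have [gy|gy] := eqVneq (bspin y) g; last first.
    apply: ordC_ge_ext (ordC_ge0 R _) => h _.
    by rewrite /ket (negbTE gy) mulr0.
  rewrite -[_ - _]addr0; apply: ordC_geM; last by apply: analyticC_ord; exact: analyticC_cst.
  rewrite -[_ - _]add0r; apply: ordC_geM; first exact: analyticC_ord.
  by rewrite -gy; exact: ord_Lambda.
split.
  do 4 (apply: analyticC_sum => ?); exact: (proj1 (term _ _ _ _)).
do 4 (apply: ordC_ge_sum => ?); exact: (proj2 (term _ _ _ _)).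
Qed.

Lemma opgbar_controlled alpha j i :
  spin_controlled (fun h => opgbar (q h) p alpha j i).
Proof.
have [[K gK] gP] := opg_controlled alpha (- i) (- j).
have ac : analyticC (fun h => (qpow (q h) (- i + j))%:C * (-1) ^ Num.floor (i - j)).
  apply: analyticCM; last exact: analyticC_cst.
  by apply: analyticC_real; apply: positive_analytic; exact: positive_qpow.
split; first by exists K => h x y xy; rewrite /opgbar gK// mulr0.
move=> x y; have [aT oT] := gP x y; split; first exact: analyticCM.
by rewrite -[_ - _]add0r; apply: ordC_geM => //; exact: analyticC_ord.
Qed.

End OperatorOrders.

(** * Composition of operators along the closed braid *)

Section BraidRuns.
Variables (R : realType) (p : R[i]) (m : nat).
Local Notation q h := (expR (h / 2) : R).
Implicit Types (Ts : R -> seq (oper R)) (u : R -> vect R) (w : seq (letter m * label)).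

Definition run Ts u h := foldl (fun v T => app T v) (u h) (Ts h).

Definition preserves_orders Ts := forall u, spin_bounded u ->
  spin_bounded (run Ts u) /\ forall k, ord_vect k u -> ord_vect k (run Ts u).

Definition raises_order k Ts := forall u, spin_bounded u -> ord_vect k (run Ts u).

Lemma preserves_nil : preserves_orders (fun=> [::]).
Proof. by move=> u. Qed.

Lemma preserves_cons T Ts : spin_controlled T -> preserves_orders Ts ->
  preserves_orders (fun h => T h :: Ts h).
Proof.
move=> cT pT u bu; have bTu := app_spin_bounded cT bu.
have [b o] := pT _ bTu; split=> // k uk; apply: o; exact: app_ord_vect.
Qed.

Lemma run_cat Ts Us u : run (fun h => Ts h ++ Us h) u = run Us (run Ts u).
Proof. by apply/funext => h; rewrite /run foldl_cat. Qed.

Lemma preserves_cat Ts Us : preserves_orders Ts -> preserves_orders Us ->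
  preserves_orders (fun h => Ts h ++ Us h).
Proof.
move=> pT pU u bu; rewrite run_cat.
have [b o] := pT _ bu; have [b' o'] := pU _ b.
by split=> // k uk; apply: o'; apply: o.
Qed.

Lemma raises_catl k Ts Us : raises_order k Ts -> preserves_orders Ts ->
  preserves_orders Us -> raises_order k (fun h => Ts h ++ Us h).
Proof.
move=> rT pT pU u bu; rewrite run_cat; have [b _] := pT _ bu.
by apply: (proj2 (pU _ b)); exact: rT.
Qed.

Lemma raises_catr k Ts Us : preserves_orders Ts -> raises_order k Us ->
  raises_order k (fun h => Ts h ++ Us h).
Proof. by move=> pT rU u bu; rewrite run_cat; apply: rU; case: (pT _ bu). Qed.

Lemma preserves_crossing l L x : preserves_orders (fun h => crossing (q h) p (m := m) l L x).
Proof.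
case: l => s []; rewrite /crossing; case: (x == lpos s); try case: (x == rpos s);
  by [exact: preserves_nil | apply: preserves_cons preserves_nil;
      (exact: opX_controlled || exact: opg_controlled || exact: opgbar_controlled)].
Qed.

Lemma preserves_pass w x : preserves_orders (fun h => pass (q h) p w x).
Proof.
elim: w x => [|[l L] w IHw] x /=; first exact: preserves_nil.
by apply: preserves_cat (IHw _); exact: preserves_crossing.
Qed.

(** The witness is the strand that records X(alpha): the left one for a positive letter, the right
    one for an inverse. *)
Lemma raises_crossing k (l : letter m) (L : label) : (2 * k <= tag L)%N ->
  exists x, raises_order k (fun h => crossing (q h) p l L x).
Proof.
move=> kL; have ka : k%:R <= lab_alpha L.
  by rewrite /lab_alpha ler_pdivlMr// -natrM ler_nat mulnC.
case: l => s [].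
  exists (lpos s); rewrite /crossing eqxx => u; exact: opX_ord_vect.
exists (rpos s); rewrite /crossing eqxx.
have -> : (rpos s == lpos s) = false.
  by apply/negbTE; rewrite -(inj_eq val_inj)/= /bump/= add1n eq_sym neq_ltn ltnSn.
move=> u; exact: opX_ord_vect.
Qed.

(** The starting position is found by following the strand backwards through the preceding
    letters. *)
Lemma raises_pass k w (l : letter m) (L : label) : (l, L) \in w ->
  (2 * k <= tag L)%N -> exists x, raises_order k (fun h => pass (q h) p w x).
Proof.
move=> + kL; elim: w => // -[l' L'] w IHw; rewrite inE => /orP[/eqP[<- <-]|lw].
  have [x rx] := raises_crossing l kL; exists x => /=.
  by apply: raises_catl => //; [exact: preserves_crossing|exact: preserves_pass].
have [y ry] := IHw lw; exists ((letter_perm l')^-1%g y) => /=.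
by rewrite permKV; apply: raises_catr => //; exact: preserves_crossing.
Qed.

Lemma preserves_sweep w s : preserves_orders
  (fun h => flatten [seq opG (q h) :: pass (q h) p w x | x <- s]).
Proof.
elim: s => [|x s IHs]; first exact: preserves_nil.
apply: (preserves_cat (Ts := fun h => opG (q h) :: pass (q h) p w x)) => //.
by apply: preserves_cons; [exact: opG_controlled|exact: preserves_pass].
Qed.

Lemma raises_sweep k w s x : x \in s -> raises_order k (fun h => pass (q h) p w x) ->
  raises_order k (fun h => flatten [seq opG (q h) :: pass (q h) p w y | y <- s]).
Proof.
move=> + rx; elim: s => // y s IHs; rewrite inE => /orP[/eqP <-|/IHs IH].
  apply: (raises_catl (Ts := fun h => opG (q h) :: pass (q h) p w x)).
  - apply: (raises_catr (Ts := fun h => [:: opG (q h)])) => //.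
    by apply: preserves_cons preserves_nil; exact: opG_controlled.
  - by apply: preserves_cons; [exact: opG_controlled|exact: preserves_pass].
  - exact: preserves_sweep.
apply: (raises_catr (Ts := fun h => opG (q h) :: pass (q h) p w y)) => //.
by apply: preserves_cons; [exact: opG_controlled|exact: preserves_pass].
Qed.

(** A single cycle contains every position, so the path visits all strands and meets the X(alpha) of
    each crossing. *)
Lemma knot_orbit (b : seq (letter m)) x : closure_is_knot b ->
  x \in fingraph.orbit (braid_perm b) ord0.
Proof.
move=> /eqP /cards1P[C CE].
have porbitC y : porbit (braid_perm b) y = C.
  by apply/set1P; rewrite -CE; exact: imset_f.
have : x \in porbit (braid_perm b) ord0 by rewrite porbitC -(porbitC x) porbit_id.
case/porbitP => i ->; rewrite -fconnect_orbit permX.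
exact: fconnect_iter.
Qed.

Lemma ket0_spin_bounded : spin_bounded (fun=> ket R 0 0).
Proof.
have k0 x : tag x != 0%N -> ket R 0 0 x = 0.
  by rewrite /ket /bspin pnatr_eq0 => /negbTE ->.
split; first by exists 1%N => _ x x0; rewrite k0// -lt0n.
move=> x; split; first exact: analyticC_cst.
have [->|x0] := eqVneq (tag x) 0%N; first by apply: analyticC_ord; exact: analyticC_cst.
by apply: ordC_ge_ext (ordC_ge0 R _) => h _; rewrite k0.
Qed.

Lemma preserves_recorded (b : seq (letter m)) (Ls : seq label) :
  preserves_orders (fun h => recorded (q h) p b Ls).
Proof. by apply: preserves_cat; [exact: preserves_pass|exact: preserves_sweep]. Qed.

Lemma analyticC_Sb_term (b : seq (letter m)) (Ls : seq label) :
  analyticC (fun h => Sb_term (q h) p b Ls).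
Proof.
by have [[_ bP] _] := preserves_recorded b Ls ket0_spin_bounded; case: (bP (@bidx0)).
Qed.

(* The strand through the crossing labelled [L] carries spin [tag L / 2] there
   but spin 0 at both ends. *)
Lemma ord_Sb_term k (b : seq (letter m)) (Ls : seq label) l L : closure_is_knot b ->
  (l, L) \in zip b Ls -> (2 * k <= tag L)%N ->
  ordC_ge k%:Z (fun h => Sb_term (q h) p b Ls).
Proof.
move=> kb lL kL; have [x rx] := raises_pass lL kL.
suff : raises_order k (fun h => recorded (q h) p b Ls).
  by move/(_ _ ket0_spin_bounded); apply.
(* [ord0] heads the orbit and is passed first; every other position belongs to the sweep. *)
have := knot_orbit x kb; rewrite /recorded /fingraph.orbit -orderSpred/= inE.
move=> /orP[/eqP x0|xs].
  by apply: raises_catl; [rewrite -x0|exact: preserves_pass|exact: preserves_sweep].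
by apply: raises_catr; [exact: preserves_pass|exact: raises_sweep xs rx].
Qed.

End BraidRuns.

(** * From real expansions to complex Taylor series *)

Section HAdic.
Variable R : realType.
Local Open Scope complex_scope.

Lemma normc_le_ReIm (z : R[i]) :
  `|z| <= (`|complex.Re z| + `|complex.Im z|)%:C.
Proof.
rewrite normc_def lecR -[leRHS]ger0_norm ?addr_ge0// -sqrtr_sqr.
rewrite ler_sqrt ?sqr_ge0// sqrrD !real_normK ?num_real//.
by rewrite -addrA lerD2l addrC lerDl mulrn_wge0// mulr_ge0.
Qed.

Lemma Re_sum n (F : 'I_n -> R[i]) :
  complex.Re (\sum_(k < n) F k) = \sum_(k < n) complex.Re (F k).
Proof. by elim/big_ind2: _ => // x1 x2 y1 y2 <- <-; rewrite ReD. Qed.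

Lemma Im_sum n (F : 'I_n -> R[i]) :
  complex.Im (\sum_(k < n) F k) = \sum_(k < n) complex.Im (F k).
Proof. by elim/big_ind2: _ => // x1 x2 y1 y2 <- <-; rewrite ImD. Qed.

Lemma expands_taylor (f : R -> R[i]) (a : fps R) :
  expands (fun k => complex.Re (a k)) (fun h => complex.Re (f h)) ->
  expands (fun k => complex.Im (a k)) (fun h => complex.Im (f h)) ->
  taylor_expansion f a.
Proof.
move=> eRe eIm; have [r [M [[r0 _ fRe] [_ _ fIm]]]] := expands_common eRe eIm.
exists r => // h /[dup] hr0 /andP[h0 hr].
apply/cvgrPdist_le => e e0.
(* In the order on complex numbers a positive [e] is real. *)
have eE : e = (complex.Re e)%:C.
  by move: e0; case: e => [x y]; rewrite ltcE/= => /andP[/eqP -> _].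
have re0 : 0 < complex.Re e by move: e0; rewrite ltcE => /andP[].
have geo : ((fun N => (M + M) * (`|h| / r) ^+ N) @ \oo --> (0 : R))%classic.
  rewrite -(mulr0 (M + M)); apply: cvgMr; apply: cvg_expr.
  by rewrite ger0_norm ?divr_ge0 ?(ltW r0)// ltr_pdivrMr// mul1r.
have /cvgrPdist_le/(_ _ re0) := geo.
apply: filterS => N; rewrite sub0r normrN => small.
rewrite eE; apply: le_trans (normc_le_ReIm _) _; rewrite lecR.
apply: le_trans small; apply: le_trans (ler_norm _); rewrite mulrDl.
set S := \sum_(k < N) _.
have ReS : complex.Re (f h - S) = complex.Re (f h) - \sum_(k < N) complex.Re (a k) * h ^+ k.
  rewrite ReD -mulN1r ReM/= oppr0 mul0r subr0 mulN1r Re_sum; congr (_ - _).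
  by apply: eq_bigr => k _; rewrite ReM/= mulr0 subr0.
have ImS : complex.Im (f h - S) = complex.Im (f h) - \sum_(k < N) complex.Im (a k) * h ^+ k.
  rewrite ImD -mulN1r ImM/= oppr0 mul0r addr0 mulN1r Im_sum; congr (_ - _).
  by apply: eq_bigr => k _; rewrite ImM/= mulr0 add0r.
by rewrite ReS ImS; apply: lerD; [exact: fRe|exact: fIm].
Qed.

End HAdic.

(** * Labellings with bounded spins *)

Section Labels.

(** The tag is twice the spin, so the condition is alpha < N. *)
Definition small_label (N : nat) (L : label) : bool := (tag L < 2 * N)%N.

Definition labels_upto (N : nat) : seq label :=
  flatten [seq [seq existT (fun a => ('I_a.+1 * 'I_a.+1)%type) a t
               | t <- enum {: 'I_a.+1 * 'I_a.+1}] | a <- iota 0 (2 * N)].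

Lemma mem_labels_upto N (L : label) : small_label N L -> L \in labels_upto N.
Proof.
case: L => a t; rewrite /small_label /= => aN; apply/flatten_mapP; exists a.
  by rewrite mem_iota.
by apply: map_f; rewrite mem_enum.
Qed.

Lemma small_labelings_finite (n N : nat) : exists F : {fset n.-tuple label},
  forall Ls : n.-tuple label, (Ls \in F) = all (small_label N) Ls.
Proof.
pose L0 : label := existT (fun a => ('I_a.+1 * 'I_a.+1)%type) 0%N (ord0, ord0).
pose r := labels_upto N.
(* Tuples of indices into [r] enumerate the candidates; the bound size r + 1 keeps the ordinals
   inhabited when [r] is empty. *)
pose S := [seq mktuple (fun i => nth L0 r (f i)) | f : {ffun 'I_n -> 'I_(size r).+1}].
exists (seq_fset tt [seq Ls : n.-tuple label <- S | all (small_label N) Ls]) => Ls.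
rewrite seq_fsetE mem_filter andb_idr// => /allP sLs.
apply/mapP; exists [ffun i => inord (index (tnth Ls i) r)]; first by rewrite mem_enum.
apply: eq_from_tnth => i; rewrite tnth_mktuple ffunE.
have Lr : tnth Ls i \in r by apply/mem_labels_upto/sLs; exact: mem_tnth.
by rewrite inordK ?nth_index// ltnS index_size.
Qed.

End Labels.

Theorem proposition23 (R : realType) (m n : nat) (b : n.-tuple (letter m))
    (p : R[i]) (knot_b : closure_is_knot b) :
  exists a : n.-tuple label -> fps R,
    (forall Ls : n.-tuple label,
        taylor_expansion (fun h : R => Sb_term (expR (h / 2)) p b Ls) (a Ls))
    /\ hadic_convergent a.
Proof.
have /choice[a aP] : forall Ls : n.-tuple label, exists c : fps R,
    expands (fun k => complex.Re (c k)) (fun h => complex.Re (Sb_term (expR (h / 2)) p b Ls)) /\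
    expands (fun k => complex.Im (c k)) (fun h => complex.Im (Sb_term (expR (h / 2)) p b Ls)).
  move=> Ls; have [[u uE] [v vE]] := analyticC_Sb_term p b Ls.
  by exists (fun k => Complex (u k) (v k)).
exists a; split=> [Ls|]; first by have [? ?] := aP Ls; exact: expands_taylor.
(* A label with alpha >= N makes the whole term O(h^N), so its coefficients below N are exactly
   0. *)
have a0 N (Ls : n.-tuple label) k : ~~ all (small_label N) Ls -> (k < N)%N -> a Ls k = 0.
  case/allPn => L /tnthP[i ->]; rewrite -leqNgt => Li kN.
  have iz : (tnth b i, tnth Ls i) \in zip b Ls.
    have -> : (tnth b i, tnth Ls i) = nth (tnth b i, tnth Ls i) (zip b Ls) i.
      by rewrite nth_zip ?size_tuple// -!tnth_nth.
    by rewrite mem_nth// size_zip !size_tuple minnn.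
  have [oRe oIm] := ord_Sb_term p knot_b iz Li; have [eRe eIm] := aP Ls.
  have := expands_coef_eq0 eRe oRe kN; have := expands_coef_eq0 eIm oIm kN.
  by case: (a Ls k) => x y /= -> ->.
have /choice[F0 F0P] := @small_labelings_finite n.
(* The coefficient of h^k only receives labellings with every alpha < k + 1. For k < N these all lie
   in [F0 N], so any larger finite set gives the same sum. *)
exists (fun k => \sum_(t <- F0 k.+1) a t k) => N; exists (F0 N) => F F0F k kN.
have sum_eq (G : {fset n.-tuple label}) : (F0 k.+1 `<=` G)%fset ->
    \sum_(t <- G) a t k = \sum_(t <- F0 k.+1) a t k.
  move=> sub; apply/esym/big_fset_incl => // Ls _ LsF.
  by apply: (a0 k.+1) => //; rewrite -F0P.
apply: sum_eq; apply/fsubsetP => Ls; rewrite F0P => /allP sLs.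
apply: (fsubsetP F0F); rewrite F0P; apply/allP => L /sLs; rewrite /small_label.
by move=> /leq_trans; apply; rewrite leq_mul2l.
Qed.
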